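(* Let $(M,g_{ab})$ be a connected Einstein pseudo-Riemannian manifold of dimension $n\ge3$ with $R_{ab}=\Lambda g_{ab}$, and let $(M,g_{ab},u,Y_{ab},\xi^a[Y],\lambda)$ be a CKY--RS structure. Put $\phi=e^{-u}$, $c=\lambda-\xi(u)$ and $$\mathcal{G}=\Delta u+(n-2)|\nabla u|^2+c\,e^{2u}.$$ Then $\phi$ satisfies the Obata-type Hessian equation $$\nabla_a\nabla_b\phi=-K\phi\, g_{ab},\qquad K=\frac{\Lambda-\mathcal{G}}{n-2}.$$
   Context: $\nabla$, $\Delta=\nabla^a\nabla_a$ and $|\cdot|^2$ are taken with respect to $g$. Conformal Killing--Yano (CKY) 2-form: a smooth 2-form $Y_{ab}$ with $\nabla_cY_{ab}=g_{ca}\xi_b-g_{cb}\xi_a+z_{abc}$, where $z_{abc}$ is totally antisymmetric and $\xi_a=\frac{1}{n-1}\nabla^bY_{ba}$; $\xi^a=\xi^a[Y]$ is its associated vector field. CKY--RS structure $(M,g_{ab},u,Y_{ab},\xi^a[Y],\lambda)$: $u\in C^\infty(M)$, $\lambda\in\mathbb{R}$, $Y$ is a CKY 2-form of $g$, and $\tilde g_{ab}=e^{2u}g_{ab}$ satisfies $\tilde R_{ab}+\frac12\mathcal{L}_{\xi}\tilde g_{ab}=\lambda\tilde g_{ab}$ with $\xi=\xi[Y]$, $\tilde R_{ab}$ being the Ricci tensor of $\tilde g$. On an Einstein background $\xi$ is a Killing field of $g$, $c$ is constant, and $\tilde R_{ab}=c\,\tilde g_{ab}$. *)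

(* Defs.v *)
From HB Require Import structures.
From mathcomp Require Import all_boot all_order all_algebra.
From mathcomp Require Import all_classical all_reals all_analysis.
Set Implicit Arguments.
Unset Strict Implicit.
Unset Printing Implicit Defensive.
Import Order.TTheory GRing.Theory Num.Theory.
Import numFieldNormedType.Exports.
Local Open Scope classical_set_scope.
Local Open Scope ring_scope.

(* C^k on an open set U of R^n: all iterated partial derivatives up to order k
   exist and are continuous at the points of U. *)
Fixpoint Ck_on (R : realType) (n k : nat) (U : set 'rV[R]_n)
    (f : 'rV[R]_n -> R) : Prop :=
  (forall v, U v -> {for v, continuous f}) /\
  (if k is k'.+1 then
     forall a : 'I_n, (forall v, U v -> derivable f v (delta_mx 0 a)) /\
       Ck_on k' U (fun v => 'D_(delta_mx 0 a) f v)
   else True).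

Definition smooth_on (R : realType) (n : nat) (U : set 'rV[R]_n)
  (f : 'rV[R]_n -> R) : Prop := forall k, Ck_on k U f.

(* A chart is a homeomorphism from the open set [dom x] onto an open set of
   R^n; [crd x] and [pnt x] are total, with junk values off [dom x] and off its
   image. *)
Record chart (R : realType) (n : nat) (M : topologicalType) := Chart {
  dom : set M;
  crd : M -> 'rV[R]_n;
  pnt : 'rV[R]_n -> M;
  dom_open : open dom;
  img_open : open (crd @` dom);
  crdK : forall p, dom p -> pnt (crd p) = p;
  crd_cont : forall p, dom p -> {for p, continuous crd};
  pnt_cont : forall v, (crd @` dom) v -> {for v, continuous pnt} }.

Record smooth_manifold (R : realType) (n : nat) := SmoothManifold {
  carrier :> topologicalType;
  hausdorff_carrier : hausdorff_space carrier;
  countable_carrier : @second_countable carrier;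
  atlas : set (chart R n carrier);
  atlas_cover : forall p, exists2 x, atlas x & dom x p;
  atlas_smooth : forall x y, atlas x -> atlas y -> forall a : 'I_n,
    smooth_on (crd x @` (dom x `&` dom y)) (fun v => crd y (pnt x v) 0 a) }.
Arguments atlas {R n} M _ : rename.

Section Calculus.
Context {R : realType} {n : nat} {M : topologicalType}.
Implicit Types (x : chart R n M) (f : M -> R) (p : M).

Definition smooth_in x f : Prop := smooth_on (crd x @` dom x) (f \o pnt x).

(* the coordinate derivative (df/dx^a)(p) *)
Definition pd x (a : 'I_n) f p : R := 'D_(delta_mx 0 a) (f \o pnt x) (crd x p).

(* [jac x y p a c] is (dx^c/dy^a)(p). *)
Definition jac x y p : 'M[R]_n :=
  \matrix_(a, c) pd y a (fun q => crd x q 0 c) p.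

End Calculus.

Definition smooth_fun (R : realType) (n : nat) (M : smooth_manifold R n)
  (f : M -> R) : Prop := forall x, atlas M x -> smooth_in x f.

(* Smooth (0,2)-tensor fields: [T x p a b] is the component T_ab at p in the
   chart x, and T'_ab = (dx^c/dy^a) (dx^d/dy^b) T_cd between charts x and y. *)
Record tensor02 (R : realType) (n : nat) (M : smooth_manifold R n) := Tensor02 {
  comp :> chart R n M -> M -> 'M[R]_n;
  comp_smooth : forall x, atlas M x ->
    forall a b, smooth_in x (fun p => comp x p a b);
  comp_change : forall x y, atlas M x -> atlas M y ->
    forall p, dom x p -> dom y p ->
    comp y p = jac x y p *m comp x p *m (jac x y p)^T }.

(* The signature is not fixed: it is automatically locally constant, hence
   constant when M is connected. *)
Record pseudo_metric (R : realType) (n : nat) (M : smooth_manifold R n) :=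
  PseudoMetric {
  metric_tensor :> tensor02 M;
  metric_sym : forall x, atlas M x -> forall p, dom x p ->
    (metric_tensor x p)^T = metric_tensor x p;
  metric_nondeg : forall x, atlas M x -> forall p, dom x p ->
    metric_tensor x p \in unitmx }.

Record two_form (R : realType) (n : nat) (M : smooth_manifold R n) := TwoForm {
  form_tensor :> tensor02 M;
  form_antisym : forall x, atlas M x -> forall p, dom x p ->
    (form_tensor x p)^T = - form_tensor x p }.

(* Below, [g], [T], [w], [X] stand for the components in the chart x of a
   metric, a (0,2)-tensor field, a 1-form and a vector field. *)
Section LocalTensorCalculus.
Context {R : realType} {n : nat} {M : topologicalType}.
Variable x : chart R n M.
Implicit Types (g T : M -> 'M[R]_n) (w X : M -> 'I_n -> R) (f : M -> R) (p : M).
Implicit Types a b c d e : 'I_n.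

(* g^ab *)
Definition ginv g p : 'M[R]_n := invmx (g p).

(* Gamma^a_bc *)
Definition christoffel g p a b c : R :=
  2^-1 * \sum_d ginv g p a d *
    (pd x b (fun q => g q d c) p + pd x c (fun q => g q d b) p
     - pd x d (fun q => g q b c) p).

(* R^d_cab, with (nabla_a nabla_b - nabla_b nabla_a) V^d = R^d_cab V^c *)
Definition riemann g p d c a b : R :=
  pd x a (fun q => christoffel g q d b c) p
  - pd x b (fun q => christoffel g q d a c) p
  + \sum_e (christoffel g p d a e * christoffel g p e b c
            - christoffel g p d b e * christoffel g p e a c).

(* R_ab = R^c_acb, positive on round spheres *)
Definition ricci g p : 'M[R]_n := \matrix_(a, b) \sum_c riemann g p c a c b.

(* nabla_a w_b *)
Definition nabla1 g w p a b : R :=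
  pd x a (fun q => w q b) p - \sum_e christoffel g p e a b * w p e.

(* nabla_c T_ab *)
Definition nabla2 g T p c a b : R :=
  pd x c (fun q => T q a b) p
  - \sum_e christoffel g p e c a * T p e b
  - \sum_e christoffel g p e c b * T p a e.

(* nabla_a nabla_b f *)
Definition hessian g f p : 'M[R]_n :=
  \matrix_(a, b) nabla1 g (fun q e => pd x e f q) p a b.

(* nabla^a nabla_a f *)
Definition laplacian g f p : R :=
  \sum_a \sum_b ginv g p a b * hessian g f p a b.

(* |nabla f|^2 *)
Definition grad_sq g f p : R :=
  \sum_a \sum_b ginv g p a b * pd x a f p * pd x b f p.

(* X(f) *)
Definition vf_app X f p : R := \sum_a X p a * pd x a f p.

(* (L_X T)_ab *)
Definition lie X T p : 'M[R]_n :=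
  \matrix_(a, b) (vf_app X (fun q => T q a b) p
    + \sum_c (T p c b * pd x a (fun q => X q c) p
              + T p a c * pd x b (fun q => X q c) p)).

(* xi_a = (n - 1)^-1 nabla^b Y_ba *)
Definition xi_form g (Y : M -> 'M[R]_n) p a : R :=
  (n%:R - 1)^-1 * \sum_b \sum_d ginv g p b d * nabla2 g Y p d b a.

(* xi^a *)
Definition xi_vect g (Y : M -> 'M[R]_n) p a : R :=
  \sum_b ginv g p a b * xi_form g Y p b.

End LocalTensorCalculus.

Definition totally_antisymmetric (R : realType) (n : nat)
  (z : 'I_n -> 'I_n -> 'I_n -> R) : Prop :=
  forall a b c, z a b c = - z b a c /\ z a b c = - z a c b.

Section Structures.
Context {R : realType} {n : nat} {M : smooth_manifold R n}.
Implicit Types (g : pseudo_metric M) (Y : two_form M) (u : M -> R).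

Definition einstein g (Lambda : R) : Prop :=
  forall x, atlas M x -> forall p, dom x p ->
    ricci x (g x) p = Lambda *: g x p.

(* z is the difference of smooth tensor fields, hence itself a smooth 3-form,
   although its existence is only asked for at each point. *)
Definition cky g Y : Prop :=
  forall x, atlas M x -> forall p, dom x p ->
  exists2 z, totally_antisymmetric z &
    forall c a b, nabla2 x (g x) (Y x) p c a b =
      g x p c a * xi_form x (g x) (Y x) p b
      - g x p c b * xi_form x (g x) (Y x) p a + z c a b.

(* e^{2u} g *)
Definition conformal u (g : chart R n M -> M -> 'M[R]_n) x p : 'M[R]_n :=
  expR (2 * u p) *: g x p.

Definition cky_rs g u Y (lambda : R) : Prop :=
  [/\ smooth_fun u, cky g Y &
    forall x, atlas M x -> forall p, dom x p ->
      ricci x (conformal u g x) p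
      + 2^-1 *: lie x (xi_vect x (g x) (Y x)) (conformal u g x) p
      = lambda *: conformal u g x p].

End Structures.

(* Main.v *)
Require Import Defs.
From HB Require Import structures.
From mathcomp Require Import all_boot all_order all_algebra.
From mathcomp Require Import all_classical all_reals all_analysis.
From mathcomp Require Import ring lra.
Import Order.TTheory GRing.Theory Num.Theory.
Import numFieldNormedType.Exports.
Local Open Scope classical_set_scope.
Local Open Scope ring_scope.

Set Implicit Arguments.
Unset Strict Implicit.
Unset Printing Implicit Defensive.

(* In the rescaled metric e^{2u} g, the conformal change formula reads
   R~_ab = R_ab - (n-2) (nabla_a nabla_b u - u_a u_b)
           - (Delta u + (n-2) |nabla u|^2) g_ab,
   so everything rests on xi being a Killing field of g: then
   L_xi (e^{2u} g) = 2 xi(u) e^{2u} g, the soliton equation becomes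
   R~_ab = (lambda - xi(u)) e^{2u} g_ab, and it can be solved for
   nabla_a nabla_b e^{-u} = e^{-u} (u_a u_b - nabla_a nabla_b u).

   For the Killing property put S_ab = nabla_a xi_b. Antisymmetrize
   nabla_d nabla_c Y_ab in d and c by the Ricci identity, contract with g^ca
   and symmetrize in d and b. On an Einstein metric the curvature terms cancel
   (the Ricci term is Lambda Y_db, and the Riemann term is antisymmetric by pair
   symmetry), as do those in the 3-form z, which leaves
   (n-2) (S_db + S_bd) + 2 g_db tr S = 0; its trace gives tr S = 0. *)

(** * Smooth functions on open subsets of R^n *)

Section SmoothCalculus.
Context {R : realType} {n : nat}.
Implicit Types (U : set 'rV[R]_n) (f g h : 'rV[R]_n -> R) (v w : 'rV[R]_n).

(** Both difference quotients are the same function of [t]. This makes the one-variable chain rule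
    available for [expR (f y)]. *)
Lemma derive_along_line f v w :
  'D_w f v = 'D_1 (fun t : R => f (t *: w + v)) 0.
Proof.
rewrite /derive; set q1 := fun t => t^-1 *: _; set q2 := fun t => t^-1 *: _.
suff -> : q1 = q2 by [].
by apply/funext => t; rewrite /q1 /q2 /= addr0 scale0r add0r [_%:A]mulr1.
Qed.

Lemma is_derive_expR_comp f v w : derivable f v w ->
  is_derive v w (fun y => expR (f y)) (expR (f v) * 'D_w f v).
Proof.
move=> /derivable1P fw.
have [dE eE] : is_derive (0 : R) 1
    (expR \o (fun t : R => f (t *: w + v))) (expR (f v) * 'D_w f v).
  apply: is_derive1_comp; rewrite /= ?scale0r ?add0r ?derive_along_line.
    exact: is_derive_expR.
  exact: derivableP.
split; first exact/derivable1P.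
by rewrite derive_along_line [LHS]eE.
Qed.

Lemma open_near_eq U f g v : open U -> (forall w, U w -> f w = g w) -> U v ->
  \near v, f v = g v.
Proof.
by move=> oU fg Uv; apply: filterS (open_nbhs_nbhs (conj oU Uv)) => w /fg.
Qed.

Lemma open_continuous_eq U f g v : open U ->
  (forall w, U w -> f w = g w) -> U v ->
  {for v, continuous f} -> {for v, continuous g}.
Proof.
move=> oU fg Uv cf A; rewrite -fg // => /cf fA.
have UV : nbhs v U by exact: open_nbhs_nbhs.
by apply: filterS2 UV fA => w /fg Ew /=; rewrite Ew.
Qed.

(** Derivatives at a point of the open set [U] depend only on values near it, so the behaviour off
    [U] is irrelevant. This is how junk values of charts outside their domains are discarded. *)
Lemma Ck_on_eq k U f g : open U -> (forall v, U v -> f v = g v) ->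
  Ck_on k U f -> Ck_on k U g.
Proof.
move=> oU; elim: k f g => [|k IH] f g fg /= [cf df].
  by split=> // v Uv; exact: (open_continuous_eq oU fg Uv (cf v Uv)).
split; first by move=> v Uv; exact: (open_continuous_eq oU fg Uv (cf v Uv)).
move=> a; have [df1 df2] := df a; split=> [v Uv|].
  by apply: near_eq_derivable (df1 v Uv); exact: (open_near_eq oU fg Uv).
apply: IH df2 => v Uv; apply: near_eq_derive; exact: (open_near_eq oU fg Uv).
Qed.

Lemma Ck_onW k U f : Ck_on k.+1 U f -> Ck_on k U f.
Proof.
elim: k f => [|k IH] f [cf df]; split=> // a.
by have [df1 /IH] := df a.
Qed.

Lemma Ck_on_cst k U (r : R) : Ck_on k U (fun=> r).
Proof.
elim: k r => [|k IH] r; first by split=> // v _; exact: cst_continuous.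
split=> [v _|a]; first exact: cst_continuous.
split=> [v _|]; first exact: derivable_cst.
suff -> : (fun v => 'D_(delta_mx 0 a) (fun=> r) v) = fun=> 0 by exact: IH.
by apply/funext => v; exact: derive_cst.
Qed.

(** The common induction step of the closure properties below: a closed formula for the partial
    derivatives has to hold only on [U], where it may replace the total functions in [Ck_on]. *)
Lemma Ck_on_step k U f (df : 'I_n -> 'rV[R]_n -> R) : open U ->
  (forall v, U v -> {for v, continuous f}) ->
  (forall a v, U v -> is_derive v (delta_mx 0 a) f (df a v)) ->
  (forall a, Ck_on k U (df a)) -> Ck_on k.+1 U f.
Proof.
move=> oU cf fdf cdf; split=> // a; split=> [v Uv|].
  by case: (fdf a v Uv).
by apply: Ck_on_eq (cdf a) => // v Uv; case: (fdf a v Uv).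
Qed.

Lemma Ck_on_cont k U f v : Ck_on k U f -> U v -> {for v, continuous f}.
Proof. by case: k => [|k] [cf _]; exact: cf. Qed.

Lemma Ck_on_derivable k U f a v : Ck_on k.+1 U f -> U v ->
  is_derive v (delta_mx 0 a) f ('D_(delta_mx 0 a) f v).
Proof. by move=> [_ /(_ a)[df _]] Uv; exact/derivableP/df. Qed.

Lemma Ck_on_derive k U f a :
  Ck_on k.+1 U f -> Ck_on k U (fun v => 'D_(delta_mx 0 a) f v).
Proof. by move=> [_ /(_ a)[]]. Qed.

Lemma Ck_onD k U f g : open U -> Ck_on k U f -> Ck_on k U g ->
  Ck_on k U (fun v => f v + g v).
Proof.
move=> oU; elim: k f g => [|k IH] f g fk gk.
  by split=> // v Uv; apply: continuousD;
    [exact: (Ck_on_cont fk Uv)|exact: (Ck_on_cont gk Uv)].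
apply: (@Ck_on_step _ _ _ (fun a v =>
   'D_(delta_mx 0 a) f v + 'D_(delta_mx 0 a) g v)) => //.
- by move=> v Uv; apply: continuousD;
    [exact: (Ck_on_cont fk Uv)|exact: (Ck_on_cont gk Uv)].
- move=> a v Uv; apply: is_deriveD; first exact: Ck_on_derivable fk Uv.
  exact: Ck_on_derivable gk Uv.
- by move=> a; apply: IH; exact: Ck_on_derive.
Qed.

Lemma Ck_onM k U f g : open U -> Ck_on k U f -> Ck_on k U g ->
  Ck_on k U (fun v => f v * g v).
Proof.
move=> oU; elim: k f g => [|k IH] f g fk gk.
  by split=> // v Uv; apply: continuousM;
    [exact: (Ck_on_cont fk Uv)|exact: (Ck_on_cont gk Uv)].
apply: (@Ck_on_step _ _ _ (fun a v =>
   f v * 'D_(delta_mx 0 a) g v + g v * 'D_(delta_mx 0 a) f v)) => //.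
- by move=> v Uv; apply: continuousM;
    [exact: (Ck_on_cont fk Uv)|exact: (Ck_on_cont gk Uv)].
- move=> a v Uv; apply: is_deriveM; first exact: Ck_on_derivable fk Uv.
  exact: Ck_on_derivable gk Uv.
- by move=> a; apply: Ck_onD => //; apply: IH;
    by [exact: Ck_onW | exact: Ck_on_derive].
Qed.

(** The derivative of 1/f is built from 1/f itself and a derivative of [f], so the induction on [k]
    can keep [f] fixed. The same holds for [expR] below. *)
Lemma Ck_onV k U f : open U -> (forall v, U v -> f v != 0) -> Ck_on k U f ->
  Ck_on k U (fun v => (f v)^-1).
Proof.
move=> oU f0; elim: k => [|k IH] fk.
  by split=> // v Uv; apply: continuousV; [exact: f0 | exact: (Ck_on_cont fk Uv)].
apply: (@Ck_on_step _ _ _ (fun a v =>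
   -1 * ((f v)^-1 * (f v)^-1) * 'D_(delta_mx 0 a) f v)) => //.
- by move=> v Uv; apply: continuousV; [exact: f0 | exact: (Ck_on_cont fk Uv)].
- move=> a v Uv; have [dfv _] := @Ck_on_derivable _ _ _ a _ fk Uv.
  split; first by apply: derivableV => //; exact: f0.
  by rewrite deriveV ?f0// /GRing.scale /= mulN1r -expr2 -exprVn.
- move=> a; apply: Ck_onM (Ck_on_derive _ _) => //.
  apply: Ck_onM (Ck_on_cst _ _ _) _ => //.
  by apply: Ck_onM => //; apply: IH; exact: Ck_onW.
Qed.

Lemma Ck_on_expR k U f : open U -> Ck_on k U f ->
  Ck_on k U (fun v => expR (f v)).
Proof.
move=> oU; elim: k => [|k IH] fk.
  split=> // v Uv; apply: continuous_comp; last exact: continuous_expR.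
  exact: (Ck_on_cont fk Uv).
apply: (@Ck_on_step _ _ _ (fun a v =>
   expR (f v) * 'D_(delta_mx 0 a) f v)) => //.
- move=> v Uv; apply: continuous_comp; last exact: continuous_expR.
  exact: (Ck_on_cont fk Uv).
- move=> a v Uv; apply: is_derive_expR_comp.
  by have [dfv _] := @Ck_on_derivable _ _ _ a _ fk Uv.
- move=> a; apply: Ck_onM => //; last exact: Ck_on_derive.
  by apply: IH; exact: Ck_onW.
Qed.

End SmoothCalculus.

(** * Symmetry of second partial derivatives *)

Section Clairaut.
Context {R : realType} {n : nat}.
Implicit Types (U : set 'rV[R]_n) (f : 'rV[R]_n -> R) (v w : 'rV[R]_n).

Lemma is_derive_line f v w (t : R) : derivable f (t *: w + v) w ->
  is_derive t 1 (fun s : R => f (s *: w + v)) ('D_w f (t *: w + v)).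
Proof.
move=> fw; suff E : (fun h : R => h^-1 *: (((fun s : R => f (s *: w + v)) \o
      shift t) (h *: 1) - f (t *: w + v)))
    = (fun h : R => h^-1 *: ((f \o shift (t *: w + v)) (h *: w) -
         f (t *: w + v))).
  by split; rewrite /derivable /derive E.
by apply/funext => h /=; rewrite [h *: 1]mulr1 scalerDl addrA.
Qed.

Lemma MVT_line f v w (h : R) : 0 < h ->
  (forall t, 0 <= t <= h -> derivable f (t *: w + v) w) ->
  exists2 t, 0 <= t <= h & f (h *: w + v) - f v = 'D_w f (t *: w + v) * h.
Proof.
move=> h0 df.
have fD t : t \in `[0, h] -> is_derive t 1 (fun s : R => f (s *: w + v))
    ('D_w f (t *: w + v)).
  by rewrite in_itv /= => /df; exact: is_derive_line.
have MVTf := @MVT R (fun s => f (s *: w + v)) (fun s => 'D_w f (s *: w + v))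
    0 h h0.
have fO t : t \in `]0, h[ -> t \in `[0, h].
  by rewrite !in_itv /= => /andP[t0 th]; rewrite !ltW.
have fC : {within `[0, h], continuous (fun s : R => f (s *: w + v))}.
  by apply: derivable_within_continuous => t /fD[].
have [c] := MVTf (fun t th => fD t (fO t th)) fC.
rewrite in_itv /= => /andP[c0 ch]; rewrite scale0r add0r subr0 => E.
by exists c => //; rewrite !ltW.
Qed.

(** The mean value theorem is used twice: along [p] for the first difference [phi] in direction [q],
    then along [q] for the derivative of [f] along [p]. The second difference thus equals h^2 times
    the mixed derivative at a point that tends to [v], and continuity finishes. *)
Lemma second_difference_cvg U f v p q : open U -> U v ->
  (forall w, U w -> derivable f w p) ->
  (forall w, U w -> derivable ('D_p f) w q) ->
  {for v, continuous ('D_q ('D_p f))} ->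
  (f (h *: p + (h *: q + v)) - f (h *: p + v) - f (h *: q + v) + f v) / h ^+ 2
    @[h --> (0:R)^'+] --> 'D_q ('D_p f) v.
Proof.
move=> oU Uv fp fpq cfpq; apply/cvgrPdist_lt => e e0.
have : \forall w \near v, U w /\ `|'D_q ('D_p f) v - 'D_q ('D_p f) w| < e.
  have /cvgrPdist_lt/(_ e e0) near1 := cfpq.
  have UV : nbhs v U by exact: open_nbhs_nbhs.
  by apply: filterS2 UV near1.
move=> /nbhs_ballP[r /= r0 rU].
(* Intermediate points lie within h (|p| + |q|) of [v]; the extra 1 makes [N] positive even when [p]
   and [q] vanish. *)
pose N := `|p| + `|q| + 1.
have N0 : 0 < N by rewrite ltr_wpDl // addr_ge0.
have small s t h : h < r / N -> 0 <= s <= h -> 0 <= t <= h ->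
    ball v r (s *: p + (t *: q + v)).
  move=> hr /andP[s0 sh] /andP[t0 th]; rewrite -ball_normE /=.
  rewrite addrA opprD addrCA subrr addr0 normrN.
  apply: le_lt_trans (ler_normD _ _) _; rewrite !normrZ !ger0_norm//.
  have h0 : 0 <= h := le_trans s0 sh.
  move: hr; rewrite ltr_pdivlMr // => /(le_lt_trans _); apply.
  rewrite /N !mulrDr mulr1 ler_wpDr // lerD //; exact: ler_wpM2r.
have rN : 0 < r / N by rewrite divr_gt0.
near=> h.
have h0 : 0 < h by [].
have hr : h < r / N by near: h; exact: nbhs_right_lt.
have hh : 0 <= h <= h by rewrite lexx ltW.
have h00 : 0 <= (0:R) <= h by rewrite lexx ltW.
pose phi w := f (w + h *: q) - f w.
have phiD t : 0 <= t <= h -> is_derive (t *: p + v) p phi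
    ('D_p f (t *: p + v + h *: q) - 'D_p f (t *: p + v)).
  move=> th.
  have shift_derive : is_derive (t *: p + v) p (fun w => f (w + h *: q))
      ('D_p f (t *: p + v + h *: q)).
    have E : (fun k : R => k^-1 *: (((fun w => f (w + h *: q)) \o
        shift (t *: p + v)) (k *: p) - f (t *: p + v + h *: q)))
      = (fun k : R => k^-1 *: ((f \o shift (t *: p + v + h *: q)) (k *: p)
          - f (t *: p + v + h *: q))).
      by apply/funext => k /=; rewrite !addrA.
    have : derivable f (t *: p + v + h *: q) p.
      apply: fp; rewrite -addrA [v + _]addrC.
      by have [] := rU _ (small t h h hr th hh).
    by split; rewrite /derivable /derive E.
  have fD : is_derive (t *: p + v) p f ('D_p f (t *: p + v)).
    apply: derivableP; apply: fp.
    by have [] := rU _ (small t 0 h hr th h00); rewrite scale0r add0r.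
  exact: (is_deriveB shift_derive fD).
have [|s sh Es] := @MVT_line phi v p h h0; first by move=> t /phiD[].
have [_ E1] := phiD s sh; rewrite E1 in Es.
have [|t th Et] := @MVT_line ('D_p f) (s *: p + v) q h h0.
  move=> t th; apply: fpq; rewrite addrCA.
  by have [] := rU _ (small s t h hr sh th).
have -> : f (h *: p + (h *: q + v)) - f (h *: p + v) - f (h *: q + v) + f v
    = 'D_q ('D_p f) (t *: q + (s *: p + v)) * h * h.
  rewrite -Et [h *: q + (s *: p + v)]addrC -Es /phi.
  rewrite -[h *: p + v + _]addrA [v + h *: q]addrC; ring.
have hn0 : h != 0 by rewrite gt_eqF.
rewrite -mulrA -expr2 mulfK ?expf_neq0 // addrCA.
by have [] := rU _ (small s t h hr sh th).
Unshelve. all: by end_near. Qed.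

(** The second difference is symmetric in its two directions, so both mixed derivatives are limits
    of the same quotient. *)
Lemma Ck_on_derive_comm U f v a b : open U -> Ck_on 2 U f -> U v ->
  'D_(delta_mx 0 a) ('D_(delta_mx 0 b) f) v =
  'D_(delta_mx 0 b) ('D_(delta_mx 0 a) f) v.
Proof.
move=> oU fk Uv.
have sd c d := @second_difference_cvg U f v (delta_mx 0 c) (delta_mx 0 d) oU Uv
  (fun w Uw => let: DeriveDef df _ := @Ck_on_derivable _ _ _ _ _ c _ fk Uw in df)
  (fun w Uw => let: DeriveDef df _ :=
     @Ck_on_derivable _ _ _ _ _ d _ (Ck_on_derive c fk) Uw in df)
  (Ck_on_cont (Ck_on_derive d (Ck_on_derive c fk)) Uv).
apply: (cvg_unique _ (sd b a)) => //.
rewrite (_ : (fun _ => _) = (fun h : R =>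
  (f (h *: delta_mx 0 a + (h *: delta_mx 0 b + v)) - f (h *: delta_mx 0 a + v)
   - f (h *: delta_mx 0 b + v) + f v) / h ^+ 2)); first exact: sd.
apply/funext => h; congr (_ / _); rewrite addrCA; ring.
Qed.

End Clairaut.

(** * Coordinate derivatives in a chart *)

Section ChartCalculus.
Context {R : realType} {n : nat} {M : topologicalType}.
Variable x : chart R n M.
Implicit Types (f h : M -> R) (a b : 'I_n) (p q : M).

Let U := crd x @` dom x.
Let openU : open U := @img_open _ _ _ x.

Lemma crdK_img v : U v -> crd x (pnt x v) = v.
Proof. by move=> [p xp <-]; rewrite crdK. Qed.

Lemma pnt_dom v : U v -> dom x (pnt x v).
Proof. by move=> [p xp <-]; rewrite crdK. Qed.

Lemma smooth_in_eq f h : (forall q, dom x q -> f q = h q) ->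
  smooth_in x f -> smooth_in x h.
Proof.
by move=> fh sf k; apply: Ck_on_eq (sf k) => // v /pnt_dom /fh.
Qed.

Lemma smooth_in_cst (r : R) : smooth_in x (fun=> r).
Proof. by move=> k; exact: Ck_on_cst. Qed.

Lemma smooth_inD f h : smooth_in x f -> smooth_in x h ->
  smooth_in x (fun q => f q + h q).
Proof. by move=> sf sh k; exact: Ck_onD (sf k) (sh k). Qed.

Lemma smooth_inM f h : smooth_in x f -> smooth_in x h ->
  smooth_in x (fun q => f q * h q).
Proof. by move=> sf sh k; exact: Ck_onM (sf k) (sh k). Qed.

Lemma smooth_inN f : smooth_in x f -> smooth_in x (fun q => - f q).
Proof.
move=> sf; apply: (@smooth_in_eq (fun q => -1 * f q)) => [q _|].
  by rewrite mulN1r.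
exact: smooth_inM (smooth_in_cst _) sf.
Qed.

Lemma smooth_inB f h : smooth_in x f -> smooth_in x h ->
  smooth_in x (fun q => f q - h q).
Proof. by move=> sf sh; exact: smooth_inD sf (smooth_inN sh). Qed.

Lemma smooth_inV f : (forall q, dom x q -> f q != 0) -> smooth_in x f ->
  smooth_in x (fun q => (f q)^-1).
Proof.
by move=> f0 sf k; apply: Ck_onV (sf k) => // v /pnt_dom /f0.
Qed.

Lemma smooth_in_expR f : smooth_in x f -> smooth_in x (fun q => expR (f q)).
Proof. by move=> sf k; exact: Ck_on_expR (sf k). Qed.

Lemma smooth_in_sum (I : Type) (r : seq I) (P : pred I) (F : I -> M -> R) :
  (forall i, smooth_in x (F i)) ->
  smooth_in x (fun q => \sum_(i <- r | P i) F i q).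
Proof.
move=> sF; elim: r => [|i r IH].
  by apply: smooth_in_eq (smooth_in_cst 0) => q _; rewrite big_nil.
apply: (@smooth_in_eq (fun q => (P i)%:R * F i q + \sum_(i <- r | P i) F i q)).
  by move=> q _; rewrite big_cons; case: (P i); rewrite ?mul1r ?mul0r ?add0r.
exact: smooth_inD (smooth_inM (smooth_in_cst _) (sF i)) IH.
Qed.

Lemma smooth_in_prod (I : Type) (r : seq I) (P : pred I) (F : I -> M -> R) :
  (forall i, smooth_in x (F i)) ->
  smooth_in x (fun q => \prod_(i <- r | P i) F i q).
Proof.
move=> sF; elim: r => [|i r IH].
  by apply: smooth_in_eq (smooth_in_cst 1) => q _; rewrite big_nil.
case Pi : (P i).
  apply: (@smooth_in_eq (fun q => F i q * \prod_(i <- r | P i) F i q)).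
    by move=> q _; rewrite big_cons Pi.
  exact: smooth_inM (sF i) IH.
by apply: smooth_in_eq IH => q _; rewrite big_cons Pi.
Qed.

Lemma smooth_in_pd f a : smooth_in x f -> smooth_in x (pd x a f).
Proof.
move=> sf k; apply: Ck_on_eq (Ck_on_derive a (sf k.+1)) => // v Uv.
by rewrite /= /pd crdK_img.
Qed.

Lemma pd_is_derive f a p : smooth_in x f -> dom x p ->
  is_derive (crd x p) (delta_mx 0 a) (f \o pnt x) (pd x a f p).
Proof. by move=> sf xp; apply: (Ck_on_derivable _ (sf 1%N)); exists p. Qed.

Lemma pd_eq f h a p : (forall q, dom x q -> f q = h q) -> dom x p ->
  pd x a f p = pd x a h p.
Proof.
move=> fh xp; apply: near_eq_derive; apply: (@open_near_eq _ _ U) => //.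
  by move=> v /pnt_dom /fh.
by exists p.
Qed.

Lemma pd_cst (r : R) a p : pd x a (fun=> r) p = 0.
Proof. exact: derive_cst. Qed.

Lemma pdD f h a p : smooth_in x f -> smooth_in x h -> dom x p ->
  pd x a (fun q => f q + h q) p = pd x a f p + pd x a h p.
Proof.
move=> sf sh xp.
by case: (is_deriveD (pd_is_derive a sf xp) (pd_is_derive a sh xp)).
Qed.

Lemma pdN f a p : smooth_in x f -> dom x p ->
  pd x a (fun q => - f q) p = - pd x a f p.
Proof. by move=> sf xp; case: (is_deriveN (pd_is_derive a sf xp)). Qed.

Lemma pdB f h a p : smooth_in x f -> smooth_in x h -> dom x p ->
  pd x a (fun q => f q - h q) p = pd x a f p - pd x a h p.
Proof. by move=> sf sh xp; rewrite pdD ?pdN//; exact: smooth_inN. Qed.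

Lemma pdM f h a p : smooth_in x f -> smooth_in x h -> dom x p ->
  pd x a (fun q => f q * h q) p = pd x a f p * h p + f p * pd x a h p.
Proof.
move=> sf sh xp.
case: (is_deriveM (pd_is_derive a sf xp) (pd_is_derive a sh xp)) => _.
rewrite /GRing.scale /= crdK// => E; rewrite addrC [_ * h p]mulrC.
exact: E.
Qed.

Lemma pd_expR f a p : smooth_in x f -> dom x p ->
  pd x a (fun q => expR (f q)) p = expR (f p) * pd x a f p.
Proof.
move=> sf xp; have [df _] := pd_is_derive a sf xp.
by case: (is_derive_expR_comp df); rewrite /= crdK.
Qed.

Lemma pd_sum (I : Type) (r : seq I) (F : I -> M -> R) a p :
  (forall i, smooth_in x (F i)) -> dom x p ->
  pd x a (fun q => \sum_(i <- r) F i q) p = \sum_(i <- r) pd x a (F i) p.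
Proof.
move=> sF xp; elim: r => [|i r IH].
  rewrite big_nil (@pd_eq _ (fun=> 0) a p) ?pd_cst// => q _.
  by rewrite big_nil.
rewrite big_cons -IH -pdD//; last exact: smooth_in_sum.
by apply: pd_eq xp => q _; rewrite big_cons.
Qed.

Lemma pd_comm f a b p : smooth_in x f -> dom x p ->
  pd x a (pd x b f) p = pd x b (pd x a f) p.
Proof.
move=> sf xp; have Up : U (crd x p) by exists p.
(* The inner [pd] is evaluated at [crd x (pnt x v)], which is [v] only on the image of the chart;
   the two sides agree near [crd x p] because that image is open. *)
have E c d : pd x c (pd x d f) p =
    'D_(delta_mx 0 c) ('D_(delta_mx 0 d) (f \o pnt x)) (crd x p).
  apply: near_eq_derive; apply: (@open_near_eq _ _ U) => // v Uv.
  by rewrite /= /pd crdK_img.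
by rewrite !E; apply: (Ck_on_derive_comm a b openU (sf 2%N) Up).
Qed.

Lemma smooth_in_det m (A : M -> 'M[R]_m) :
  (forall i j, smooth_in x (fun q => A q i j)) ->
  smooth_in x (fun q => \det (A q)).
Proof.
move=> sA; apply: smooth_in_sum => s.
apply: smooth_inM (smooth_in_cst _) _.
by apply: smooth_in_prod => i; exact: sA.
Qed.

(** By the cofactor formula the entries of the inverse are polynomials in the entries of [g] divided
    by the determinant. *)
Lemma smooth_in_ginv (g : M -> 'M[R]_n) :
  (forall i j, smooth_in x (fun q => g q i j)) ->
  (forall q, dom x q -> g q \in unitmx) ->
  forall i j, smooth_in x (fun q => ginv g q i j).
Proof.
move=> sg ug i j.
apply: (@smooth_in_eq (fun q => (\det (g q))^-1 *
   ((-1) ^+ (j + i) * \det (row' j (col' i (g q)))))).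
  by move=> q xq; rewrite /ginv /invmx ug// !mxE.
apply: smooth_inM; first apply: smooth_inV => [q /ug|].
- by rewrite unitmxE unitfE.
- exact: smooth_in_det.
apply: smooth_inM (smooth_in_cst _) _; apply: smooth_in_det => k l.
by apply: smooth_in_eq (sg (lift j k) (lift i l)) => q _; rewrite !mxE.
Qed.

End ChartCalculus.

(** * Christoffel symbols *)

(* [ring] tests its atoms for convertibility, which unfolds the analytic
   definitions inside them; generalizing the atoms first avoids that. *)
Ltac abstract_atoms :=
  repeat match goal with
  | |- context [@bigop ?T ?I ?idx ?r ?F] => generalize (@bigop T I idx r F); intro
  | |- context [pd ?x ?a ?f ?p] => generalize (pd x a f p); intro
  | |- context [christoffel ?x ?g ?p ?a ?b ?c] =>
      generalize (christoffel x g p a b c); intro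
  | |- context [xi_form ?x ?g ?Y ?p ?a] => generalize (xi_form x g Y p a); intro
  | |- context [fun_of_matrix ?A ?i ?j] => generalize (fun_of_matrix A i j); intro
  end.
Ltac abstract_ring := abstract_atoms; ring.

(** * Contractions with the Kronecker delta *)

Section Kronecker.
Context {R : comPzRingType} {n : nat}.
Implicit Types (F : 'I_n -> R) (A B : 'M[R]_n).

Lemma sum_deltar F a : \sum_e F e * (e == a)%:R = F a.
Proof.
rewrite (bigD1 a) //= eqxx mulr1 big1 ?addr0// => e /negPf ->.
by rewrite mulr0.
Qed.

Lemma sum_deltal F a : \sum_e (a == e)%:R * F e = F a.
Proof. by rewrite -[RHS]sum_deltar; apply: eq_bigr => e _; rewrite mulrC eq_sym. Qed.

Lemma mulmx1_sum A B a b : A *m B = 1%:M -> \sum_e A a e * B e b = (a == b)%:R.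
Proof. by move/matrixP/(_ a b); rewrite !mxE. Qed.

End Kronecker.

Section ChristoffelSymbols.
Context {R : realType} {n : nat} {M : topologicalType}.
Variables (x : chart R n M) (g : M -> 'M[R]_n).
Hypothesis smooth_g : forall a b, smooth_in x (fun q => g q a b).
Hypothesis sym_g : forall q, dom x q -> (g q)^T = g q.
Hypothesis unit_g : forall q, dom x q -> g q \in unitmx.
Implicit Types (a b c d e : 'I_n) (p q : M).

Local Notation "'Gam'" := (christoffel x g).

Lemma metricC q a b : dom x q -> g q a b = g q b a.
Proof. by move=> /sym_g E; rewrite -{1}E mxE. Qed.

Lemma ginvC q a b : dom x q -> ginv g q a b = ginv g q b a.
Proof. by move=> /sym_g E; rewrite /ginv -{1}E -trmx_inv mxE. Qed.

Lemma ginv_mul q a b : dom x q ->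
  \sum_e ginv g q a e * g q e b = (a == b)%:R.
Proof. by move=> xq; apply: mulmx1_sum; rewrite mulVmx ?unit_g. Qed.

Lemma mul_ginv q a b : dom x q ->
  \sum_e g q a e * ginv g q e b = (a == b)%:R.
Proof. by move=> xq; apply: mulmx1_sum; rewrite mulmxV ?unit_g. Qed.

Lemma smooth_ginv a b : smooth_in x (fun q => ginv g q a b).
Proof. exact: smooth_in_ginv. Qed.

Lemma smooth_christoffel a b c : smooth_in x (fun q => Gam q a b c).
Proof.
apply: smooth_inM (smooth_in_cst _ _) _; apply: smooth_in_sum => d.
apply: smooth_inM; first exact: smooth_ginv.
by apply: smooth_inB; first apply: smooth_inD; exact: smooth_in_pd.
Qed.

Lemma pd_metricC a b c p : dom x p ->
  pd x a (fun q => g q b c) p = pd x a (fun q => g q c b) p.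
Proof. by apply: pd_eq => q xq; rewrite metricC. Qed.

Lemma christoffelC p a b c : dom x p -> Gam p a b c = Gam p a c b.
Proof.
move=> xp; congr (_ * _); apply: eq_bigr => d _; congr (_ * _).
by rewrite (pd_metricC d b c xp) [_ + pd x c _ p]addrC.
Qed.

(** Contracting with [g] cancels the inverse metric in the definition and leaves the Christoffel
    symbols of the first kind. *)
Lemma christoffel_lower p b c f : dom x p ->
  \sum_e Gam p e b c * g p e f =
  2^-1 * (pd x b (fun q => g q f c) p + pd x c (fun q => g q f b) p
          - pd x f (fun q => g q b c) p).
Proof.
move=> xp; rewrite /christoffel.
under [LHS]eq_bigr do rewrite -mulrA mulr_suml.
rewrite -mulr_sumr exchange_big /=; congr (_ * _).
rewrite -[RHS](sum_deltar (fun d => pd x b (fun q => g q d c) p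
  + pd x c (fun q => g q d b) p - pd x d (fun q => g q b c) p) f).
apply: eq_bigr => d _.
rewrite -(ginv_mul _ _ xp) mulr_sumr; apply: eq_bigr => e _.
by rewrite (ginvC e d xp); ring.
Qed.

(** This is nabla g = 0 written out. Of the six derivatives of [g] in the two lowered symbols, four
    cancel by symmetry of [g] and two add up to the left side. *)
Lemma metric_compat p a b c : dom x p ->
  pd x c (fun q => g q a b) p =
  \sum_e Gam p e c a * g p e b + \sum_e Gam p e c b * g p a e.
Proof.
move=> xp; rewrite christoffel_lower//.
under [X in _ + X]eq_bigr do rewrite (metricC a _ xp).
rewrite christoffel_lower// (pd_metricC c b a xp) (pd_metricC a b c xp).
by rewrite (pd_metricC a c b xp) (pd_metricC b c a xp); field.
Qed.

Lemma nabla2_metric p c a b : dom x p -> nabla2 x g g p c a b = 0.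
Proof. by move=> xp; rewrite /nabla2 metric_compat//; ring. Qed.

(** Differentiate g^ae g_ed = delta^a_d, insert [metric_compat] for the derivative of [g], and solve
    by multiplying with the inverse metric. *)
Lemma pd_ginv p a b c : dom x p ->
  pd x c (fun q => ginv g q a b) p =
  - (\sum_e Gam p a c e * ginv g p e b) - \sum_e Gam p b c e * ginv g p a e.
Proof.
move=> xp.
have E d : \sum_e (pd x c (fun q => ginv g q a e) p * g p e d +
    ginv g p a e * pd x c (fun q => g q e d) p) = 0.
  rewrite -[RHS](pd_cst x ((a == d)%:R) c p).
  transitivity (pd x c (fun q => \sum_e ginv g q a e * g q e d) p).
    rewrite pd_sum// => [|e]; last exact: smooth_inM (smooth_ginv _ _) _.
    by apply: eq_bigr => e _; rewrite pdM//; exact: smooth_ginv.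
  by apply: pd_eq xp => q xq; rewrite ginv_mul.
(* In one of the two connection terms g^ae meets g_fe and collapses to a single Christoffel
   symbol. *)
have {}E d : \sum_e pd x c (fun q => ginv g q a e) p * g p e d =
    - Gam p a c d - \sum_e \sum_f ginv g p a e * Gam p f c e * g p f d.
  apply/eqP; rewrite -subr_eq0 -[X in _ == X](E d) big_split /=; apply/eqP.
  under [X in _ = _ + X]eq_bigr do rewrite metric_compat// mulrDr.
  rewrite big_split /= !opprD !opprK; congr (_ + _); rewrite addrC.
  congr (_ + _); last first.
    apply: eq_bigr => e _; rewrite mulr_sumr.
    by apply: eq_bigr => f _; rewrite mulrA.
  rewrite -[LHS](sum_deltal (fun f => Gam p f c d) a).
  under [LHS]eq_bigr do rewrite -(ginv_mul _ _ xp) mulr_suml.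
  rewrite exchange_big; apply: eq_bigr => e _; rewrite mulr_sumr.
  by apply: eq_bigr => f _; rewrite mulrAC -mulrA.
(* The delta is expanded as [g] times [ginv], so that [E] applies to the first factor. *)
rewrite -[LHS](sum_deltar (fun e => pd x c (fun q => ginv g q a e) p)).
under [LHS]eq_bigr do rewrite -(mul_ginv _ _ xp) mulr_sumr.
rewrite exchange_big /=.
under [LHS]eq_bigr => d _.
  under eq_bigr do rewrite mulrA.
  rewrite -mulr_suml E mulrBl mulNr mulr_suml; over.
rewrite sumrB sumrN; congr (_ - _).
rewrite exchange_big /=; apply: eq_bigr => e _.
under [LHS]eq_bigr do rewrite mulr_suml.
rewrite exchange_big /= -(sum_deltar (fun f => Gam p f c e) b) mulr_suml.
apply: eq_bigr => f _; rewrite -(mul_ginv _ _ xp) mulr_sumr mulr_suml.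
by apply: eq_bigr => d _; ring.
Qed.

End ChristoffelSymbols.

(** * Curvature *)

Local Opaque pd christoffel.

(* the terms of second covariant derivatives of P with connection matrices C
   (in the direction c) and D (in the direction d) *)
Lemma ricci_identity_mx (R : comPzRingType) (n : nat)
    (P Pc Pd Pdc C D C' D' : 'M[R]_n) :
  Pdc - (C' *m P + C *m Pd) - (Pd *m C^T + P *m C'^T)
    - (D *m Pc - D *m (C *m P) - D *m (P *m C^T))
    - (Pc *m D^T - C *m P *m D^T - P *m C^T *m D^T)
  - (Pdc - (D' *m P + D *m Pc) - (Pc *m D^T + P *m D'^T)
    - (C *m Pd - C *m (D *m P) - C *m (P *m D^T))
    - (Pd *m C^T - D *m P *m C^T - P *m D^T *m C^T))
  = - ((C' - D' + C *m D - D *m C) *m P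
       + P *m (C' - D' + C *m D - D *m C)^T).
Proof.
have trN (A : 'M[R]_n) : (- A)^T = - A^T by exact: linearN.
have trD (A B : 'M[R]_n) : (A + B)^T = A^T + B^T by exact: linearD.
rewrite !(trD, trN) !trmx_mul !(mulmxDl, mulmxDr, mulNmx, mulmxN) !mulmxA.
apply/matrixP => a b.
have mxD (A B : 'M[R]_n) : (A + B) a b = A a b + B a b by rewrite mxE.
have mxN (A : 'M[R]_n) : (- A) a b = - A a b by rewrite mxE.
rewrite !(mxD, mxN). ring.
Qed.

(** The classical argument: the cyclic identity is taken once for each of the four possible last
    indices, the antisymmetries bring the terms to common form, and a linear combination gives the
    claim. *)
Lemma curvature_pair_sym (R : realFieldType) (I : Type)
    (K : I -> I -> I -> I -> R) :
  (forall d c a f, K d c a f = - K c d a f) ->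
  (forall d c a f, K d c a f = - K d c f a) ->
  (forall d c a f, K d c a f + K c a d f + K a d c f = 0) ->
  forall d c a f, K d c a f = K a f d c.
Proof.
move=> A1 A2 B d c a f.
have := B d c a f.
have := B c a f d; rewrite (A2 c a f d) (A2 a f c d) (A1 f c a d).
have := B a f d c; rewrite (A1 f d a c) (A2 d f a c) (A1 d a f c) (A2 a d f c).
have := B f d c a; rewrite (A1 f d c a) (A2 d c f a) (A2 c f d a).
lra.
Qed.

Section Curvature.
Context {R : realType} {n : nat} {M : topologicalType}.
Variables (x : chart R n M) (g : M -> 'M[R]_n).
Hypothesis smooth_g : forall a b, smooth_in x (fun q => g q a b).
Hypothesis sym_g : forall q, dom x q -> (g q)^T = g q.
Hypothesis unit_g : forall q, dom x q -> g q \in unitmx.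
Implicit Types (a b c d e : 'I_n) (p q : M) (S T : M -> 'M[R]_n).

Local Notation "'Gam'" := (christoffel x g).

Definition smooth_mx T := forall a b, smooth_in x (fun q => T q a b).

Definition pd_mx c T p : 'M[R]_n := \matrix_(a, b) pd x c (fun q => T q a b) p.

(** The lower index labels the rows. Then nabla_c T is the matrix expression of [covE], [curv] is
    the usual curvature expression in the matrices [conn], and the Ricci identity becomes matrix
    algebra. *)
Definition conn c q : 'M[R]_n := \matrix_(a, e) Gam q e c a.

Definition cov c T q : 'M[R]_n := \matrix_(a, b) nabla2 x g T q c a b.

Definition curv d c p : 'M[R]_n := \matrix_(a, e) riemann x g p e a d c.

Let smooth_conn c : smooth_mx (conn c).
Proof.
move=> a e; apply: smooth_in_eq (smooth_christoffel smooth_g unit_g e c a).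
by move=> q _; rewrite mxE.
Qed.

Lemma smooth_pd_mx c T : smooth_mx T -> smooth_mx (pd_mx c T).
Proof.
move=> sT a b; apply: smooth_in_eq (smooth_in_pd c (sT a b)) => q _.
by rewrite mxE.
Qed.

Lemma smooth_mxM S T : smooth_mx S -> smooth_mx T ->
  smooth_mx (fun q => S q *m T q).
Proof.
move=> sS sT a b.
apply: (@smooth_in_eq _ _ _ _ (fun q => \sum_e S q a e * T q e b)).
  by move=> q _; rewrite mxE.
by apply: smooth_in_sum => e; apply: smooth_inM.
Qed.

Lemma smooth_mx_tr T : smooth_mx T -> smooth_mx (fun q => (T q)^T).
Proof.
by move=> sT a b; apply: smooth_in_eq (sT b a) => q _; rewrite mxE.
Qed.

Lemma smooth_mxB S T : smooth_mx S -> smooth_mx T ->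
  smooth_mx (fun q => S q - T q).
Proof.
move=> sS sT a b; apply: smooth_in_eq (smooth_inB (sS a b) (sT a b)) => q _.
by rewrite !mxE.
Qed.

Lemma pd_mx_eq c S T p : (forall q, dom x q -> S q = T q) -> dom x p ->
  pd_mx c S p = pd_mx c T p.
Proof.
move=> ST xp; apply/matrixP => a b; rewrite !mxE; apply: pd_eq xp => q /ST ->.
by [].
Qed.

Lemma pd_mxB c S T p : smooth_mx S -> smooth_mx T -> dom x p ->
  pd_mx c (fun q => S q - T q) p = pd_mx c S p - pd_mx c T p.
Proof.
move=> sS sT xp; apply/matrixP => a b; rewrite !mxE -pdB//.
by apply: pd_eq xp => q _; rewrite !mxE.
Qed.

Lemma pd_mxM c S T p : smooth_mx S -> smooth_mx T -> dom x p ->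
  pd_mx c (fun q => S q *m T q) p = pd_mx c S p *m T p + S p *m pd_mx c T p.
Proof.
move=> sS sT xp; apply/matrixP => a b; rewrite !mxE.
transitivity (pd x c (fun q => \sum_e S q a e * T q e b) p).
  by apply: pd_eq xp => q _; rewrite mxE.
rewrite pd_sum// => [|e]; last exact: smooth_inM.
by rewrite -big_split; apply: eq_bigr => e _; rewrite pdM// !mxE.
Qed.

Lemma pd_mx_tr c T p : pd_mx c (fun q => (T q)^T) p = (pd_mx c T p)^T.
Proof.
apply/matrixP => a b; rewrite !mxE; congr (pd x c _ p).
by apply/funext => q; rewrite mxE.
Qed.

Lemma pd_mx_comm c d T p : smooth_mx T -> dom x p ->
  pd_mx c (pd_mx d T) p = pd_mx d (pd_mx c T) p.
Proof.
move=> sT xp; apply/matrixP => a b.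
have E k l : pd_mx k (pd_mx l T) p a b =
    pd x k (pd x l (fun q => T q a b)) p.
  by rewrite mxE; apply: pd_eq xp => q _; rewrite mxE.
rewrite [LHS]E [RHS]E; exact: (pd_comm c d (sT a b) xp).
Qed.

Lemma covE c T q :
  cov c T q = pd_mx c T q - conn c q *m T q - T q *m (conn c q)^T.
Proof.
apply/matrixP => a b; rewrite !mxE; congr (_ - _ - _).
  by apply: eq_bigr => e _; rewrite !mxE.
by apply: eq_bigr => e _; rewrite !mxE mulrC.
Qed.

Lemma smooth_cov c T : smooth_mx T -> smooth_mx (cov c T).
Proof.
move=> sT a b.
have := smooth_mxB (smooth_mxB (smooth_pd_mx c sT)
  (smooth_mxM (@smooth_conn c) sT))
  (smooth_mxM sT (smooth_mx_tr (@smooth_conn c))).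
by move/(_ a b); apply: smooth_in_eq => q _; rewrite covE.
Qed.

Lemma curvE d c p : curv d c p = pd_mx d (conn c) p - pd_mx c (conn d) p
  + conn c p *m conn d p - conn d p *m conn c p.
Proof.
apply/matrixP => a e; rewrite !mxE -addrA -sumrB; congr (_ - _ + _).
- by congr (pd x d _ p); apply/funext => q; rewrite mxE.
- by congr (pd x c _ p); apply/funext => q; rewrite mxE.
- by apply: eq_bigr => f _; rewrite !mxE; abstract_ring.
Qed.

(** [cov d (cov c T)] has no connection term for the index [c]. In the full second covariant
    derivative that term is symmetric in [c] and [d] by absence of torsion, so the commutator is
    still the tensorial one. *)
Lemma ricci_identity d c T p : smooth_mx T -> dom x p ->
  cov d (cov c T) p - cov c (cov d T) p =
  - (curv d c p *m T p + T p *m (curv d c p)^T).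
Proof.
move=> sT xp.
have E k l : cov k (cov l T) p =
    pd_mx k (pd_mx l T) p
    - (pd_mx k (conn l) p *m T p + conn l p *m pd_mx k T p)
    - (pd_mx k T p *m (conn l p)^T + T p *m (pd_mx k (conn l) p)^T)
    - (conn k p *m (pd_mx l T p) - conn k p *m (conn l p *m T p)
       - conn k p *m (T p *m (conn l p)^T))
    - (pd_mx l T p *m (conn k p)^T - conn l p *m T p *m (conn k p)^T
       - T p *m (conn l p)^T *m (conn k p)^T).
  have s1 := smooth_mxM (@smooth_conn l) sT.
  have s2 := smooth_mxM sT (smooth_mx_tr (@smooth_conn l)).
  rewrite covE (@pd_mx_eq k _ (fun q => pd_mx l T q - conn l q *m T q
    - T q *m (conn l q)^T))//; last by move=> q _; exact: covE.
  rewrite pd_mxB//; last exact: smooth_mxB (smooth_pd_mx l sT) s1.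
  rewrite pd_mxB//; last exact: smooth_pd_mx.
  rewrite pd_mxM// pd_mxM//; last exact: smooth_mx_tr.
  by rewrite (pd_mx_tr k (conn l)) covE !mulmxBl !mulmxBr.
rewrite !E (pd_mx_comm c d sT xp) curvE.
exact: ricci_identity_mx.
Qed.

Lemma riemann_antisym p e a d c : riemann x g p e a d c = - riemann x g p e a c d.
Proof.
rewrite /riemann opprD opprB -sumrN; congr (_ + _).
by apply: eq_bigr => f _; rewrite opprB.
Qed.

(** Symmetry of the Christoffel symbols in their lower indices makes the derivative terms telescope
    around the cycle and the quadratic terms cancel in pairs. *)
Lemma bianchi p e a d c : dom x p ->
  riemann x g p e a d c + riemann x g p e d c a + riemann x g p e c a d = 0.
Proof.
move=> xp; rewrite /riemann.
have pdC k l m : pd x k (fun q => Gam q e l m) p = pd x k (fun q => Gam q e m l) p.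
  by apply: pd_eq xp => q xq; rewrite christoffelC.
rewrite (pdC d a c) (pdC c d a) (pdC a c d).
have E (u v w F G H : R) : F + G + H = 0 ->
  u - v + F + (v - w + G) + (w - u + H) = 0.
  by move=> E; rewrite -[RHS]E; ring.
apply: E; rewrite -!big_split /= big1// => f _.
rewrite (christoffelC sym_g f a c xp)
  (christoffelC sym_g f d a xp)
  (christoffelC sym_g f c d xp); abstract_ring.
Qed.

(* K d c a f is R_{fadc} *)
Definition riemann_low p d c a f : R :=
  \sum_e riemann x g p e a d c * g p e f.
Local Notation K := riemann_low.

Lemma riemann_low_antisym12 p d c a f : K p d c a f = - K p c d a f.
Proof.
rewrite /K -sumrN; apply: eq_bigr => e _.
by rewrite riemann_antisym mulNr.
Qed.

(** The Ricci identity is applied to [g] itself, whose covariant derivatives vanish. *)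
Lemma riemann_low_antisym34 p d c a f : dom x p -> K p d c a f = - K p d c f a.
Proof.
move=> xp; apply/eqP; rewrite -addr_eq0; apply/eqP.
have cov0 l q : dom x q -> cov l g q = 0.
  by move=> xq; apply/matrixP => i j; rewrite !mxE nabla2_metric.
have ccov0 k l : cov k (cov l g) p = 0.
  rewrite covE cov0// mulmx0 mul0mx !subr0.
  apply/matrixP => i j; rewrite mxE [RHS]mxE -(pd_cst x (0 : R) k p).
  by apply: pd_eq xp => q xq; rewrite cov0// mxE.
have := ricci_identity d c smooth_g xp.
rewrite !ccov0 subrr => /eqP; rewrite eq_sym oppr_eq0 => /eqP/matrixP/(_ a f).
rewrite !mxE => E; rewrite -[RHS]E; congr (_ + _); apply: eq_bigr => e _.
  by rewrite mxE.
by rewrite !mxE mulrC (metricC sym_g a e xp).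
Qed.

Lemma riemann_low_bianchi p d c a f : dom x p ->
  K p d c a f + K p c a d f + K p a d c f = 0.
Proof.
move=> xp; rewrite -!big_split /= big1// => e _.
by rewrite -!mulrDl bianchi ?mul0r.
Qed.

Lemma riemann_low_pair p d c a f : dom x p -> K p d c a f = K p a f d c.
Proof.
move=> xp.
apply: curvature_pair_sym => *.
- exact: riemann_low_antisym12.
- exact: riemann_low_antisym34.
- exact: riemann_low_bianchi.
Qed.

Lemma ricci_low p a b : dom x p ->
  \sum_c \sum_f K p c b a f * ginv g p f c = ricci x g p a b.
Proof.
move=> xp; rewrite mxE; apply: eq_bigr => c _.
rewrite -[RHS](sum_deltar (fun e => riemann x g p e a c b) c).
under eq_bigr do rewrite mulr_suml.
rewrite exchange_big; apply: eq_bigr => e _.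
rewrite -(mul_ginv unit_g e c xp) mulr_sumr.
by apply: eq_bigr => f _; rewrite mulrA.
Qed.

End Curvature.

(** * The Killing property *)

Section KillingContraction.
Context {R : realType} {n : nat}.
Variables (g h Y S : 'I_n -> 'I_n -> R) (K Z : 'I_n -> 'I_n -> 'I_n -> 'I_n -> R)
  (Lambda : R).
Hypothesis n_ge3 : (3 <= n)%N.
Hypothesis gC : forall a b, g a b = g b a.
Hypothesis hC : forall a b, h a b = h b a.
Hypothesis hg : forall a b, \sum_e h a e * g e b = (a == b)%:R.
Hypothesis KA12 : forall d c a f, K d c a f = - K c d a f.
Hypothesis KA34 : forall d c a f, K d c a f = - K d c f a.
Hypothesis Kpair : forall d c a f, K d c a f = K a f d c.
Hypothesis KRic : forall a b, \sum_c \sum_f K c b a f * h f c = Lambda * g a b.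
Hypothesis YA : forall a b, Y a b = - Y b a.
Hypothesis ZA : forall d, totally_antisymmetric (Z d).
Implicit Types (F G : 'I_n -> 'I_n -> R) (a b c d e f : 'I_n).

Let ctr F := \sum_c \sum_a h c a * F c a.
Let Yup f b := \sum_e h f e * Y e b.

Let ctrD F G : ctr (fun c a => F c a + G c a) = ctr F + ctr G.
Proof.
rewrite /ctr -big_split; apply: eq_bigr => c _ /=.
by rewrite -big_split; apply: eq_bigr => a _; rewrite mulrDr.
Qed.

Let ctrN F : ctr (fun c a => - F c a) = - ctr F.
Proof.
rewrite /ctr -sumrN; apply: eq_bigr => c _ /=.
by rewrite -sumrN; apply: eq_bigr => a _; rewrite mulrN.
Qed.

Let ctrZ F k : ctr (fun c a => F c a * k) = ctr F * k.
Proof.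
rewrite /ctr mulr_suml; apply: eq_bigr => c _ /=.
by rewrite mulr_suml; apply: eq_bigr => a _; rewrite mulrA.
Qed.

Let ctr_eq F G : (forall c a, F c a = G c a) -> ctr F = ctr G.
Proof.
by move=> FG; apply: eq_bigr => c _; apply: eq_bigr => a _; rewrite FG.
Qed.

Let gh a b : \sum_e g a e * h e b = (a == b)%:R.
Proof.
rewrite eq_sym -hg; apply: eq_bigr => e _.
by rewrite gC hC mulrC.
Qed.

Let ctr_g : ctr g = n%:R.
Proof.
rewrite /ctr -[X in _ = X%:R]card_ord -sumr_const; apply: eq_bigr => c _.
under eq_bigr do rewrite gC.
by rewrite hg eqxx.
Qed.

Let lowerY d b : \sum_f g f d * Yup f b = Y d b.
Proof.
rewrite -[RHS](sum_deltal (fun e => Y e b) d).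
under [RHS]eq_bigr do rewrite -gh mulr_suml.
rewrite exchange_big; apply: eq_bigr => f _; rewrite mulr_sumr.
by apply: eq_bigr => e _; rewrite mulrA gC.
Qed.

Let ricci_term d b :
  ctr (fun c a => \sum_f K d c a f * Yup f b) = Lambda * Y d b.
Proof.
rewrite -lowerY mulr_sumr /ctr.
under eq_bigr => c _.
  under eq_bigr do rewrite mulr_sumr.
  rewrite exchange_big /=; over.
rewrite exchange_big /=; apply: eq_bigr => f _.
rewrite mulrA -KRic mulr_suml; apply: eq_bigr => c _.
rewrite mulr_suml; apply: eq_bigr => a _.
(* Flipping both antisymmetric index pairs turns the summand into that of [KRic]. *)
by rewrite KA12 KA34 opprK hC mulrCA mulrA.
Qed.

(** The term in which the full Riemann tensor survives. It pairs the curvature with [Q], which is Y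
    with both indices raised. *)
Let weyl_term d b := ctr (fun c a => \sum_f K d c b f * Yup f a).

Let Q f c := \sum_a h c a * Yup f a.

Let QA f c : Q f c = - Q c f.
Proof.
rewrite /Q -sumrN.
under eq_bigr do rewrite mulr_sumr.
rewrite exchange_big; apply: eq_bigr => e _.
rewrite mulr_sumr -sumrN; apply: eq_bigr => a _.
by rewrite [Y e a]YA; ring.
Qed.

Let weyl_termE d b : weyl_term d b = \sum_c \sum_f K d c b f * Q f c.
Proof.
apply: eq_bigr => c _; under eq_bigr do rewrite mulr_sumr.
rewrite exchange_big; apply: eq_bigr => f _; rewrite mulr_sumr.
by apply: eq_bigr => a _; rewrite mulrCA.
Qed.

(* exchanging d and b amounts to exchanging the arguments of Q *)
Let weyl_termA d b : weyl_term b d = - weyl_term d b.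
Proof.
rewrite !weyl_termE -sumrN exchange_big; apply: eq_bigr => c _.
rewrite -sumrN; apply: eq_bigr => f _.
by rewrite Kpair QA mulrN.
Qed.

(** Up to sign the divergence of the 3-form z. It survives the contraction, but its antisymmetry
    removes it on symmetrizing. *)
Let zeta d b := ctr (fun c a => Z c d a b).

Let zetaA d b : zeta b d = - zeta d b.
Proof.
rewrite -ctrN; apply: ctr_eq => c a.
by rewrite (ZA c b a d).1 (ZA c a b d).2 (ZA c a d b).1 opprK.
Qed.

Let ctr_Z d b : ctr (fun c a => Z d c a b) = 0.
Proof.
have E : ctr (fun c a => Z d c a b) = - ctr (fun c a => Z d c a b).
  rewrite -[RHS]ctrN /ctr exchange_big; apply: eq_bigr => c _.
  apply: eq_bigr => a _.
  by rewrite hC (ZA d a c b).1.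
by lra.
Qed.

(** Pointwise algebra: [h] is the inverse of [g], [K] the lowered curvature, [S] stands for nabla xi
    and [Z d] for nabla_d z. The premise is the Ricci identity for Y with the CKY equation
    inserted. *)
Lemma killing_of_contraction :
  (forall d c a b,
    - (\sum_f K d c a f * Yup f b - \sum_f K d c b f * Yup f a) =
    g c a * S d b - g c b * S d a - g d a * S c b + g d b * S c a
    + Z d c a b - Z c d a b) ->
  forall a b, S a b + S b a = 0.
Proof.
move=> int.
(* Contraction with h^ca: the four metric terms give n S_db, two copies of S_db, and the trace of S;
   z_cab contributes nothing. *)
have ctr_int d b : - (Lambda * Y d b) + weyl_term d b =
    n%:R * S d b - S d b - S d b + g d b * ctr S - zeta d b.
  rewrite -ricci_term -ctrN -ctrD.
  transitivity (ctr (fun c a => g c a * S d b - g c b * S d a - g d a * S c b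
      + g d b * S c a + Z d c a b - Z c d a b)).
    by apply: ctr_eq => c a; rewrite -int opprB addrC.
  rewrite !(ctrD, ctrN) ctrZ ctr_g ctr_Z addr0.
  congr (_ - _ - _ + _ - _).
  - rewrite /ctr exchange_big -[RHS](sum_deltar (S d) b); apply: eq_bigr => a _.
    rewrite -hg mulr_sumr; apply: eq_bigr => c _.
    by rewrite hC; ring.
  - rewrite /ctr -[RHS](sum_deltar (S^~ b) d); apply: eq_bigr => c _.
    rewrite -hg mulr_sumr; apply: eq_bigr => a _.
    by rewrite gC; ring.
  - by rewrite [RHS]mulrC -ctrZ; apply: ctr_eq => c a; rewrite mulrC.
(* Adding the identity with [d] and [b] exchanged removes the antisymmetric terms in Y, the
   curvature and z. *)
have sym d b : (n%:R - 2) * (S d b + S b d) + 2 * g d b * ctr S = 0.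
  have := ctr_int d b; have := ctr_int b d.
  by rewrite weyl_termA zetaA (YA b d) (gC b d) => E1 E2; lra.
have n0 : n%:R - 2 != 0 :> R.
  by rewrite subr_eq0 eqr_nat; apply: contraTN n_ge3 => /eqP ->.
(* The trace of [sym] is (2(n-2) + 2n) tr S = 4(n-1) tr S. *)
have trS : ctr S = 0.
  have E : ctr (fun d b => (S d b + S b d) * (n%:R - 2) + g d b * (2 * ctr S)) = 0.
    rewrite {1}/ctr big1// => d _; rewrite big1// => b _.
    have -> : (S d b + S b d) * (n%:R - 2) + g d b * (2 * ctr S) = 0.
      by rewrite -[RHS](sym d b); ring.
    exact: mulr0.
  rewrite ctrD !ctrZ ctrD ctr_g in E.
  have ES : ctr (fun d b => S b d) = ctr S.
    rewrite /ctr exchange_big; apply: eq_bigr => d _; apply: eq_bigr => b _.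
    by rewrite hC.
  rewrite ES in E.
  have : (4 * (n%:R - 1)) * ctr S = 0 by rewrite -E; ring.
  move/eqP; rewrite mulf_eq0 mulf_eq0 pnatr_eq0 /= subr_eq0 pnatr_eq1.
  by case/orP => [/eqP n1|/eqP//]; move: n_ge3; rewrite n1.
move=> a b; have := sym a b; rewrite trS mulr0 addr0 => /eqP.
by rewrite mulf_eq0 (negPf n0) => /eqP.
Qed.

End KillingContraction.

(** The covariant derivative of a 3-form is again a 3-form in its last three slots: the connection
    acts alike on each slot. [P] stands for the partial derivatives. *)
Lemma antisym_cov3 (R : realType) (n : nat) (P z : 'I_n -> 'I_n -> 'I_n -> R)
    (A : 'I_n -> 'I_n -> R) :
  totally_antisymmetric P -> totally_antisymmetric z ->
  totally_antisymmetric (fun c a b => P c a b - \sum_e A e c * z e a b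
    - \sum_e A e a * z c e b - \sum_e A e b * z c a e).
Proof.
move=> PA zA c a b.
have sumN (F G : 'I_n -> R) k : (forall e, F e = - G e) ->
    \sum_e A e k * F e = - \sum_e A e k * G e.
  by move=> FG; rewrite -sumrN; apply: eq_bigr => e _; rewrite FG mulrN.
split.
- have E1 := sumN (fun e => z e a b) (fun e => z a e b) c (fun e => (zA e a b).1).
  have E2 := sumN (fun e => z c e b) (fun e => z e c b) a (fun e => (zA c e b).1).
  have E3 := sumN (z c a) (z a c) b (fun e => (zA c a e).1).
  by rewrite E1 E2 E3 (PA c a b).1; ring.
- have E1 := sumN (fun e => z e a b) (fun e => z e b a) c (fun e => (zA e a b).2).
  have E2 := sumN (fun e => z c e b) (fun e => z c b e) a (fun e => (zA c e b).2).
  have E3 := sumN (z c a) (fun e => z c e a) b (fun e => (zA c a e).2).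
  by rewrite E1 E2 E3 (PA c a b).2; ring.
Qed.

(** * The CKY equation on an Einstein background *)

Section KillingField.
Context {R : realType} {n : nat} {M : topologicalType}.
Variables (x : chart R n M) (g Y : M -> 'M[R]_n) (Lambda : R).
Hypothesis n_ge3 : (3 <= n)%N.
Hypothesis smooth_g : forall a b, smooth_in x (fun q => g q a b).
Hypothesis sym_g : forall q, dom x q -> (g q)^T = g q.
Hypothesis unit_g : forall q, dom x q -> g q \in unitmx.
Hypothesis einstein_g : forall q, dom x q -> ricci x g q = Lambda *: g q.
Hypothesis smooth_Y : forall a b, smooth_in x (fun q => Y q a b).
Hypothesis antisym_Y : forall q, dom x q -> (Y q)^T = - Y q.
Hypothesis cky_Y : forall q, dom x q -> exists2 z, totally_antisymmetric z &
  forall c a b, nabla2 x g Y q c a b =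
    g q c a * xi_form x g Y q b - g q c b * xi_form x g Y q a + z c a b.
Implicit Types (a b c d e : 'I_n) (p q : M).

Local Notation "'Gam'" := (christoffel x g).
Local Notation w := (xi_form x g Y).

Lemma smooth_nabla2 c a b : smooth_in x (fun q => nabla2 x g Y q c a b).
Proof.
have := smooth_cov smooth_g unit_g c smooth_Y a b.
by apply: smooth_in_eq => q _; rewrite mxE.
Qed.

Lemma smooth_xi_form a : smooth_in x (fun q => w q a).
Proof.
apply: smooth_inM (smooth_in_cst _ _) _.
apply: smooth_in_sum => b; apply: smooth_in_sum => d.
by apply: smooth_inM (smooth_nabla2 _ _ _); exact: smooth_ginv.
Qed.

(** The 3-form z is defined as a difference because the witnesses in [cky_Y] are chosen point by
    point; in this form it is visibly smooth and can be differentiated. *)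
Definition cky_rest q c a b :=
  nabla2 x g Y q c a b - (g q c a * w q b - g q c b * w q a).

Local Notation z := cky_rest.

Let nabla2E q c a b :
  nabla2 x g Y q c a b = g q c a * w q b - g q c b * w q a + z q c a b.
Proof. by rewrite /cky_rest addrC subrK. Qed.

Let smooth_z c a b : smooth_in x (fun q => z q c a b).
Proof.
apply: smooth_inB; first exact: smooth_nabla2.
by apply: smooth_inB; apply: smooth_inM => //; exact: smooth_xi_form.
Qed.

Let antisym_z q : dom x q -> totally_antisymmetric (z q).
Proof.
move=> /cky_Y[z' z'A E].
have zE c a b : z q c a b = z' c a b by rewrite /cky_rest E addrC addKr.
by move=> a b c; rewrite !zE; exact: z'A.
Qed.

(* nabla_d z_cab *)
Definition nabla_cky_rest p d c a b := pd x d (fun q => z q c a b) p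
  - \sum_e Gam p e d c * z p e a b - \sum_e Gam p e d a * z p c e b
  - \sum_e Gam p e d b * z p c a e.

Local Notation nz := nabla_cky_rest.

Let antisym_nz p d : dom x p -> totally_antisymmetric (nz p d).
Proof.
move=> xp; apply: antisym_cov3 (antisym_z xp) => c a b.
by split; rewrite -pdN//; apply: pd_eq xp => q /antisym_z zA;
  [exact: (zA c a b).1 | exact: (zA c a b).2].
Qed.

Let nabla1E v p a b :
  nabla1 x g v p a b = pd x a (fun q => v q b) p - \sum_e Gam p e a b * v p e.
Proof. by []. Qed.

Let covE2 T c q a b : cov x g c T q a b = nabla2 x g T q c a b.
Proof. exact: mxE. Qed.

Let nabla2_def T p c a b : nabla2 x g T p c a b = pd x c (fun q => T q a b) p
  - \sum_e Gam p e c a * T p e b - \sum_e Gam p e c b * T p a e.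
Proof. by []. Qed.

Local Opaque cky_rest xi_form nabla1 nabla2 cov.

(** The CKY equation differentiated once, with nabla g = 0. The last sum makes up for the connection
    term on the index [c], which [cov] omits. *)
Let cov2E p d c a b : dom x p ->
  cov x g d (cov x g c Y) p a b =
  g p c a * nabla1 x g w p d b - g p c b * nabla1 x g w p d a + nz p d c a b
  + \sum_e Gam p e d c * nabla2 x g Y p e a b.
Proof.
move=> xp; rewrite covE2 nabla2_def.
have -> : pd x d (fun q => cov x g c Y q a b) p =
    pd x d (fun q => g q c a) p * w p b + g p c a * pd x d (fun q => w q b) p
    - (pd x d (fun q => g q c b) p * w p a + g p c b * pd x d (fun q => w q a) p)
    + pd x d (fun q => z q c a b) p.
  have sw := smooth_xi_form.
  have s1 := smooth_inM (smooth_g c a) (sw b).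
  have s2 := smooth_inM (smooth_g c b) (sw a).
  rewrite -!pdM// -pdB// -pdD//; last exact: smooth_inB.
  by apply: pd_eq xp => q _; rewrite covE2 nabla2E.
have -> : \sum_e Gam p e d a * cov x g c Y p e b =
    (\sum_e Gam p e d a * g p c e) * w p b
    - g p c b * (\sum_e Gam p e d a * w p e) + \sum_e Gam p e d a * z p c e b.
  rewrite mulr_suml mulr_sumr -sumrB -big_split; apply: eq_bigr => e _ /=.
  by rewrite covE2 nabla2E; abstract_ring.
have -> : \sum_e Gam p e d b * cov x g c Y p a e =
    g p c a * (\sum_e Gam p e d b * w p e)
    - (\sum_e Gam p e d b * g p c e) * w p a + \sum_e Gam p e d b * z p c a e.
  rewrite mulr_suml mulr_sumr -sumrB -big_split; apply: eq_bigr => e _ /=.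
  by rewrite covE2 nabla2E; abstract_ring.
have -> : \sum_e Gam p e d c * nabla2 x g Y p e a b =
    (\sum_e Gam p e d c * g p e a) * w p b
    - (\sum_e Gam p e d c * g p e b) * w p a + \sum_e Gam p e d c * z p e a b.
  rewrite !mulr_suml -sumrB -big_split; apply: eq_bigr => e _ /=.
  by rewrite nabla2E; abstract_ring.
rewrite (metric_compat sym_g unit_g c a d xp).
rewrite (metric_compat sym_g unit_g c b d xp) !nabla1E /nabla_cky_rest.
abstract_ring.
Qed.

Let raise_lower p (r y : 'I_n -> R) : dom x p ->
  \sum_f (\sum_e r e * g p e f) * (\sum_m ginv g p f m * y m) =
  \sum_e r e * y e.
Proof.
move=> xp.
under eq_bigr do rewrite mulr_suml.
rewrite exchange_big; apply: eq_bigr => e _ /=.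
under eq_bigr do rewrite -mulrA mulr_sumr.
rewrite -mulr_sumr; congr (_ * _).
rewrite exchange_big -[RHS](sum_deltal y e); apply: eq_bigr => m _ /=.
rewrite -(mul_ginv unit_g _ _ xp) mulr_suml; apply: eq_bigr => f _.
by rewrite mulrA.
Qed.

Lemma cky_killing p a b : dom x p ->
  nabla1 x g w p a b + nabla1 x g w p b a = 0.
Proof.
move=> xp; move: a b.
have YA a b : Y p a b = - Y p b a.
  by have /matrixP/(_ b a) := antisym_Y xp; rewrite !mxE.
apply: (@killing_of_contraction _ _ (g p) (ginv g p) (Y p) (nabla1 x g w p)
  (riemann_low x g p) (nz p) Lambda).
- exact: n_ge3.
- by move=> a b; exact: (metricC sym_g a b xp).
- by move=> a b; exact: (ginvC sym_g a b xp).
- by move=> a b; exact: (ginv_mul unit_g a b xp).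
- by move=> *; exact: riemann_low_antisym12.
- by move=> *; exact: riemann_low_antisym34.
- by move=> *; exact: riemann_low_pair.
- by move=> a b; rewrite ricci_low// einstein_g// mxE.
- exact: YA.
- by move=> d; exact: antisym_nz.
(* There remains the Ricci identity for Y; [raise_lower] cancels the metric in [riemann_low] against
   the inverse metric that raises Y. *)
move=> d c a b; rewrite !raise_lower//.
have := ricci_identity smooth_g unit_g d c smooth_Y xp.
move/matrixP/(_ a b).
have mxD (A B : 'M[R]_n) : (A + B) a b = A a b + B a b by rewrite mxE.
have mxN (A : 'M[R]_n) : (- A) a b = - A a b by rewrite mxE.
rewrite !(mxD, mxN) !cov2E//.
(* The extra connection sums of the two [cov2E] now coincide and cancel in the commutator. *)
under [X in _ + X - _ = _]eq_bigr do rewrite (christoffelC sym_g _ _ _ xp).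
have -> : (curv x g d c p *m Y p) a b = \sum_e riemann x g p e a d c * Y p e b.
  by rewrite mxE; apply: eq_bigr => e _; rewrite mxE.
have -> : (Y p *m (curv x g d c p)^T) a b =
    - \sum_e riemann x g p e b d c * Y p e a.
  rewrite mxE -sumrN; apply: eq_bigr => e _.
  by rewrite !mxE (YA a e) mulrC mulrN.
by move=> <-; move: (nabla1 _ _ _) (nabla_cky_rest _ _) => S Z; ring.
Qed.

End KillingField.

(** * Conformal change *)

Section ConformalChange.
Context {R : realType} {n : nat} {M : topologicalType}.
Variables (x : chart R n M) (g : M -> 'M[R]_n) (u : M -> R).
Hypothesis smooth_g : forall a b, smooth_in x (fun q => g q a b).
Hypothesis sym_g : forall q, dom x q -> (g q)^T = g q.
Hypothesis unit_g : forall q, dom x q -> g q \in unitmx.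
Hypothesis smooth_u : smooth_in x u.
Implicit Types (a b c d e : 'I_n) (p q : M).

Local Notation "'Gam'" := (christoffel x g).
Local Notation du a := (pd x a u).

Definition rescaled q : 'M[R]_n := expR (2 * u q) *: g q.

Lemma rescaledE q a b : rescaled q a b = expR (2 * u q) * g q a b.
Proof. exact: mxE. Qed.

Lemma pd_rescaled p a b c : dom x p ->
  pd x c (fun q => rescaled q a b) p =
  expR (2 * u p) * (2 * du c p * g p a b + pd x c (fun q => g q a b) p).
Proof.
move=> xp; transitivity (pd x c (fun q => expR (2 * u q) * g q a b) p).
  by apply: pd_eq xp => q _; rewrite rescaledE.
have s2u := smooth_inM (smooth_in_cst x 2) smooth_u.
rewrite pdM// ?pd_expR// ?pdM//;
  [|exact: smooth_in_cst|exact: smooth_in_expR].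
rewrite pd_cst; ring.
Qed.

Lemma lower_raise p (w : 'I_n -> R) a : dom x p ->
  \sum_c g p a c * (\sum_b ginv g p c b * w b) = w a.
Proof.
move=> xp; rewrite -[RHS](sum_deltal w a).
under eq_bigr do rewrite mulr_sumr.
rewrite exchange_big; apply: eq_bigr => b _ /=.
rewrite -(mul_ginv unit_g a b xp) mulr_suml; apply: eq_bigr => c _.
by rewrite mulrA.
Qed.

(** Write w_b = g_be X^e and use the product rule. The lowered Christoffel symbols cancel the
    derivatives of [g] in directions [a] and [b], leaving X(g_ab). *)
Lemma lie_metric p (w : M -> 'I_n -> R) a b :
  (forall a, smooth_in x (fun q => w q a)) -> dom x p ->
  let X q c := \sum_d ginv g q c d * w q d in
  lie x X g p a b = nabla1 x g w p a b + nabla1 x g w p b a.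
Proof.
move=> sw xp X.
have sX c : smooth_in x (fun q => X q c).
  by apply: smooth_in_sum => d; apply: smooth_inM => //; exact: smooth_ginv.
have wE q c : dom x q -> w q c = \sum_d g q c d * X q d.
  by move=> xq; rewrite lower_raise.
have pdw c d : pd x c (fun q => w q d) p =
    \sum_e pd x c (fun q => g q d e) p * X p e +
    \sum_e g p d e * pd x c (fun q => X q e) p.
  rewrite -big_split /=; transitivity (pd x c (fun q => \sum_e g q d e * X q e) p).
    by apply: pd_eq xp => q xq; rewrite wE.
  rewrite pd_sum// => [|e]; last exact: smooth_inM.
  by apply: eq_bigr => e _; rewrite pdM.
have GX : \sum_e Gam p e a b * w p e =
    2^-1 * (\sum_f pd x a (fun q => g q b f) p * X p f
      + \sum_f pd x b (fun q => g q a f) p * X p f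
      - \sum_f X p f * pd x f (fun q => g q a b) p).
  rewrite -big_split -sumrB mulr_sumr /=.
  transitivity (\sum_f (\sum_e Gam p e a b * g p e f) * X p f).
    under [RHS]eq_bigr do rewrite mulr_suml.
    rewrite exchange_big; apply: eq_bigr => e _ /=.
    by rewrite wE// mulr_sumr; apply: eq_bigr => f _; rewrite mulrA.
  apply: eq_bigr => f _; rewrite (christoffel_lower sym_g unit_g a b f xp).
  rewrite (pd_metricC sym_g a f b xp) (pd_metricC sym_g b f a xp).
  abstract_ring.
rewrite mxE /vf_app big_split /= /nabla1 !pdw.
under [\sum_e Gam p e b a * _]eq_bigr do rewrite (christoffelC sym_g _ _ _ xp).
rewrite !GX.
under [\sum_i g p i b * _]eq_bigr do rewrite (metricC sym_g _ b xp).
set A := \sum_e pd x a _ p * _; set B := \sum_e pd x b _ p * _.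
set C := \sum_c X p c * _; set D := \sum_e g p b e * _; set E := \sum_e g p a e * _.
by abstract_atoms; clearbody A B C D E; field.
Qed.

Lemma lie_rescaled p (w : M -> 'I_n -> R) :
  (forall a, smooth_in x (fun q => w q a)) -> dom x p ->
  let X q c := \sum_d ginv g q c d * w q d in
  lie x X rescaled p =
  expR (2 * u p) *: (2 * vf_app x X u p *: g p + lie x X g p).
Proof.
move=> sw xp X; apply/matrixP => a b; rewrite [LHS]mxE !mxE.
rewrite mulrDr [expR _ * (_ + \sum_c _)]mulrDr addrA; congr (_ + _).
  rewrite /vf_app mulr_sumr mulr_suml !mulr_sumr -big_split /=.
  apply: eq_bigr => c _; rewrite pd_rescaled//; abstract_ring.
rewrite mulr_sumr; apply: eq_bigr => c _; rewrite !rescaledE; abstract_ring.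
Qed.

Lemma unit_rescaled q : dom x q -> rescaled q \in unitmx.
Proof.
by move=> xq; rewrite unitmxZ ?unit_g// unitfE gt_eqF// expR_gt0.
Qed.

Definition grad q a : R := \sum_d ginv g q a d * du d q.

Lemma smooth_grad a : smooth_in x (fun q => grad q a).
Proof.
apply: smooth_in_sum => d; apply: smooth_inM; first exact: smooth_ginv.
exact: smooth_in_pd.
Qed.

Lemma lower_grad q a : dom x q -> \sum_c g q a c * grad q c = du a q.
Proof. by move=> xq; rewrite lower_raise. Qed.

Lemma grad_sqE p : \sum_e du e p * grad p e = grad_sq x g u p.
Proof.
apply: eq_bigr => a _; rewrite mulr_sumr; apply: eq_bigr => b _.
abstract_ring.
Qed.

Definition christoffel_diff q a b c : R :=
  (a == c)%:R * du b q + (a == b)%:R * du c q - g q b c * grad q a.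
Local Notation C := christoffel_diff.

Local Transparent christoffel.

(** The factors e^{2u} and e^{-2u} cancel; [C] collects the derivatives of u that the product rule
    produces. *)
Lemma christoffel_rescaled q a b c : dom x q ->
  christoffel x rescaled q a b c = Gam q a b c + C q a b c.
Proof.
move=> xq; rewrite /christoffel /C.
have -> : (a == c)%:R * du b q = \sum_d ginv g q a d * g q d c * du b q.
  by rewrite -mulr_suml (ginv_mul unit_g _ _ xq).
have -> : (a == b)%:R * du c q = \sum_d ginv g q a d * g q d b * du c q.
  by rewrite -mulr_suml (ginv_mul unit_g _ _ xq).
rewrite /grad !mulr_sumr -sumrN -!big_split /=; apply: eq_bigr => d _.
have e0 : expR (2 * u q) != 0 by rewrite gt_eqF// expR_gt0.
rewrite !pd_rescaled// /ginv (invmxZ (unit_rescaled xq)).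
rewrite mxE.
move: (expR _) e0 (invmx _ _ _) => k k0 h.
by abstract_atoms; field.
Qed.

Local Opaque christoffel.

Let smooth_diff a b c : smooth_in x (fun q => C q a b c).
Proof.
have sdu k : smooth_in x (du k) by exact: smooth_in_pd.
apply: smooth_inB; last by apply: smooth_inM; [exact: smooth_g|exact: smooth_grad].
by apply: smooth_inD; apply: smooth_inM => //; exact: smooth_in_cst.
Qed.

Let trace_diff q a : dom x q -> \sum_c C q c c a = n%:R * du a q.
Proof.
move=> xq; rewrite sumrB big_split /=.
under [\sum_c (c == a)%:R * _]eq_bigr do rewrite mulrC.
rewrite (sum_deltar (fun c => du c q)).
under [\sum_c (c == c)%:R * _]eq_bigr do rewrite eqxx mul1r.
rewrite sumr_const card_ord.
under [\sum_c g q c a * _]eq_bigr do rewrite (metricC sym_g _ a xq).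
by rewrite lower_grad// addrAC subrr add0r mulr_natl.
Qed.

Let diff_contract q (F : 'I_n -> R) b a : 
  \sum_e C q e b a * F e =
  du b q * F a + du a q * F b - g q b a * \sum_e grad q e * F e.
Proof.
rewrite -(sum_deltal F a) -(sum_deltal F b) !mulr_sumr -big_split -sumrB /=.
apply: eq_bigr => e _; rewrite /christoffel_diff (eq_sym a) (eq_sym b).
abstract_ring.
Qed.

Let T p b := \sum_c Gam p c c b.

(** Gamma + C is inserted into the curvature formula: the pure Gamma terms cancel, and every trace
    of C is n du. The result stays in coordinates; its non-tensorial terms cancel only in
    [ricci_rescaled]. *)
Lemma ricci_rescaled_diff p a b : dom x p ->
  ricci x rescaled p a b - ricci x g p a b =
  \sum_c pd x c (fun q => C q c b a) p - n%:R * pd x b (du a) p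
  + n%:R * \sum_e du e p * Gam p e b a
  + \sum_e T p e * C p e b a + n%:R * \sum_e du e p * C p e b a
  - \sum_c \sum_e C p c b e * Gam p e c a
  - \sum_c \sum_e Gam p c b e * C p e c a
  - \sum_c \sum_e C p c b e * C p e c a.
Proof.
move=> xp.
have pdC c k l m : pd x c (fun q => christoffel x rescaled q k l m) p =
    pd x c (fun q => Gam q k l m) p + pd x c (fun q => C q k l m) p.
  rewrite -pdD//; last exact: smooth_christoffel.
  by apply: pd_eq xp => q xq; rewrite christoffel_rescaled.
have <- : pd x b (fun q => \sum_c C q c c a) p = n%:R * pd x b (du a) p.
  transitivity (pd x b (fun q => n%:R * du a q) p).
    by apply: pd_eq xp => q; exact: trace_diff.
  rewrite pdM//; [|exact: smooth_in_cst|exact: smooth_in_pd].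
  by rewrite pd_cst mul0r add0r.
rewrite pd_sum//.
have -> : n%:R * \sum_e du e p * Gam p e b a = \sum_c \sum_e C p c c e * Gam p e b a.
  rewrite exchange_big mulr_sumr; apply: eq_bigr => e _ /=.
  by rewrite -mulr_suml trace_diff// mulrA.
have -> : n%:R * \sum_e du e p * C p e b a = \sum_c \sum_e C p c c e * C p e b a.
  rewrite exchange_big mulr_sumr; apply: eq_bigr => e _ /=.
  by rewrite -mulr_suml trace_diff// mulrA.
have -> : \sum_e T p e * C p e b a = \sum_c \sum_e Gam p c c e * C p e b a.
  by rewrite exchange_big; apply: eq_bigr => e _ /=; rewrite -mulr_suml.
rewrite !mxE -!sumrB -!big_split -!sumrB /=; apply: eq_bigr => c _.
rewrite /riemann !pdC.
have -> : \sum_e (christoffel x rescaled p c c e * christoffel x rescaled p e b a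
     - christoffel x rescaled p c b e * christoffel x rescaled p e c a) =
   \sum_e (Gam p c c e * Gam p e b a - Gam p c b e * Gam p e c a)
   + \sum_e C p c c e * Gam p e b a + \sum_e Gam p c c e * C p e b a
   + \sum_e C p c c e * C p e b a - \sum_e C p c b e * Gam p e c a
   - \sum_e Gam p c b e * C p e c a - \sum_e C p c b e * C p e c a.
  rewrite -!big_split -!sumrB /=; apply: eq_bigr => e _.
  rewrite !christoffel_rescaled//.
  by move: (C p) => Cp; abstract_ring.
set S1 := \sum_e C p c c e * Gam p e b a; set S2 := \sum_e Gam p c c e * C p e b a.
set S3 := \sum_e C p c c e * C p e b a; set S4 := \sum_e C p c b e * Gam p e c a.
set S5 := \sum_e Gam p c b e * C p e c a; set S6 := \sum_e C p c b e * C p e c a.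
by abstract_ring.
Qed.

Let sum_pd_diff p a b : dom x p ->
  \sum_c pd x c (fun q => C q c b a) p =
  2 * pd x a (du b) p - \sum_c grad p c * pd x c (fun q => g q b a) p
  - g p b a * \sum_c pd x c (fun q => grad q c) p.
Proof.
move=> xp; rewrite mulr_natl mulr2n {2}(pd_comm a b smooth_u xp).
rewrite -(sum_deltal (fun c => pd x c (du b) p) a).
rewrite -(sum_deltal (fun c => pd x c (du a) p) b).
rewrite mulr_sumr -big_split -!sumrB /=; apply: eq_bigr => c _.
have sd k : smooth_in x (du k) by exact: smooth_in_pd.
have sk (r : R) := smooth_in_cst x r; have sg := smooth_grad c.
have s1 k (r : R) := smooth_inM (sk r) (sd k).
have s2 := smooth_inM (smooth_g b a) sg.
rewrite pdB//; last exact: smooth_inD.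
rewrite pdD// !pdM// !pd_cst (eq_sym a) (eq_sym b); abstract_ring.
Qed.

Let diff_contract2 q (F : 'I_n -> 'I_n -> R) b :
  \sum_c \sum_e C q c b e * F c e =
  du b q * (\sum_c F c c) + \sum_e du e q * F b e
  - \sum_c grad q c * \sum_e F c e * g q b e.
Proof.
rewrite -(sum_deltal (fun c => \sum_e du e q * F c e) b) mulr_sumr.
rewrite -big_split -sumrB /=; apply: eq_bigr => c _.
rewrite -{1}(sum_deltal (F c) c) !mulr_sumr -big_split -sumrB /=.
apply: eq_bigr => e _; rewrite /christoffel_diff (eq_sym b); abstract_ring.
Qed.

Let sum_grad_metric p a : dom x p -> \sum_c grad p c * g p c a = du a p.
Proof.
move=> xp; rewrite -(lower_grad a xp); apply: eq_bigr => c _.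
by rewrite mulrC (metricC sym_g _ _ xp).
Qed.

(** The derivative of the inverse metric gives two connection terms: one cancels the sum with [T],
    the other is the Christoffel part of the Hessian. *)
Lemma laplacian_div p : dom x p ->
  \sum_c pd x c (fun q => grad q c) p + \sum_e T p e * grad p e =
  laplacian x g u p.
Proof.
move=> xp.
have pdg c : pd x c (fun q => grad q c) p =
    \sum_d (- (\sum_e Gam p c c e * ginv g p e d)
           - \sum_e Gam p d c e * ginv g p c e) * du d p
    + \sum_d ginv g p c d * pd x c (du d) p.
  have sd k : smooth_in x (du k) by exact: smooth_in_pd.
  have sh k l := smooth_ginv smooth_g unit_g k l.
  rewrite pd_sum// => [|d]; last exact: smooth_inM.
  rewrite -big_split; apply: eq_bigr => d _ /=.
  by rewrite pdM// (pd_ginv smooth_g sym_g unit_g c d c xp).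
have -> : \sum_e T p e * grad p e =
    \sum_c \sum_d (\sum_e Gam p c c e * ginv g p e d) * du d p.
  under [RHS]eq_bigr => c _.
    under eq_bigr do rewrite mulr_suml.
    rewrite exchange_big /=; over.
  rewrite exchange_big; apply: eq_bigr => e _ /=.
  rewrite mulr_suml; apply: eq_bigr => c _; rewrite mulr_sumr.
  by apply: eq_bigr => d _; rewrite mulrA.
rewrite -big_split /=; apply: eq_bigr => c _.
rewrite pdg addrAC -big_split /=.
under [X in X + _ = _]eq_bigr do rewrite mulrBl mulNr addrAC addNr add0r.
rewrite sumrN addrC.
transitivity (\sum_d ginv g p c d * (pd x c (du d) p - \sum_e Gam p e c d * du e p)).
  under [RHS]eq_bigr do rewrite mulrBr.
  rewrite sumrB; congr (_ - _).
  under eq_bigr do rewrite mulr_suml.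
  rewrite exchange_big; apply: eq_bigr => e _ /=; rewrite mulr_sumr.
  by apply: eq_bigr => d _; abstract_ring.
by apply: eq_bigr => d _; rewrite mxE.
Qed.

Lemma hessianE p a b :
  hessian x g u p a b = pd x a (du b) p - \sum_e Gam p e a b * du e p.
Proof. by rewrite mxE. Qed.

Lemma ricci_rescaled p a b : dom x p ->
  ricci x rescaled p a b = ricci x g p a b
  - (n%:R - 2) * (hessian x g u p a b - du a p * du b p)
  - (laplacian x g u p + (n%:R - 2) * grad_sq x g u p) * g p a b.
Proof.
move=> xp; apply/eqP; rewrite -!addrA addrC -subr_eq; apply/eqP.
rewrite ricci_rescaled_diff// sum_pd_diff// -laplacian_div// -grad_sqE hessianE.
have GamC := christoffelC sym_g _ _ _ xp.
(* Names for what survives the contractions: [N] is |nabla u|^2, [Gdu] the Christoffel part of the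
   Hessian, [TU] completes the divergence to the Laplacian, and [V] + [W] is u^c times the
   derivative of g_ab along c. In the end [V], [W] and the products of [T] with du cancel. *)
pose N := \sum_e du e p * grad p e.
pose Gdu := \sum_e Gam p e a b * du e p.
pose TU := \sum_e T p e * grad p e.
pose V := \sum_c grad p c * \sum_e Gam p e c a * g p b e.
pose W := \sum_c grad p c * \sum_e Gam p e c b * g p e a.
have EG : \sum_e du e p * Gam p e b a = Gdu.
  by apply: eq_bigr => e _; rewrite GamC mulrC.
have E4 : \sum_e T p e * C p e b a = du b p * T p a + du a p * T p b - g p a b * TU.
  under eq_bigr do rewrite mulrC.
  rewrite diff_contract (metricC sym_g b a xp); congr (_ - _ * _).
  by apply: eq_bigr => e _; rewrite mulrC.
have E5 : \sum_e du e p * C p e b a = 2 * (du a p * du b p) - g p a b * N.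
  under eq_bigr do rewrite mulrC.
  rewrite (diff_contract _ (fun e => du e p)) (metricC sym_g b a xp).
  have -> : \sum_e grad p e * du e p = N by apply: eq_bigr => e _; rewrite mulrC.
  abstract_ring.
have E6 : \sum_c \sum_e C p c b e * Gam p e c a = du b p * T p a + Gdu - V.
  by rewrite diff_contract2 EG.
have E7 : \sum_c \sum_e Gam p c b e * C p e c a = Gdu + du a p * T p b - W.
  have Ec c : \sum_e Gam p c b e * C p e c a =
      du c p * Gam p c b a + du a p * Gam p c b c
      - g p c a * \sum_e grad p e * Gam p c b e.
    by under eq_bigr do rewrite mulrC; rewrite diff_contract.
  under eq_bigr do rewrite Ec.
  rewrite sumrB big_split /= EG -mulr_sumr; congr (_ + _ * _ - _).
    by apply: eq_bigr => c _; rewrite GamC.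
  under eq_bigr do rewrite mulr_sumr.
  rewrite exchange_big; apply: eq_bigr => e _ /=; rewrite mulr_sumr.
  by apply: eq_bigr => c _; rewrite (GamC c b e); abstract_ring.
(* The trace of C gives n u_a u_b, [E5] gives 2 u_a u_b and one [N] term, and the gradient sum gives
   the second [N] term. *)
have E8 : \sum_c \sum_e C p c b e * C p e c a =
    (n%:R + 2) * (du a p * du b p) - 2 * (g p a b * N).
  rewrite (diff_contract2 p (fun c e => C p e c a)) trace_diff// E5.
  under [\sum_c grad p c * _]eq_bigr do rewrite diff_contract.
  have -> : \sum_c grad p c * (du c p * g p b a + du a p * g p b c
      - g p c a * \sum_e grad p e * g p b e) = g p a b * N.
    under eq_bigr do rewrite mulrBr mulrDr.
    rewrite sumrB big_split /= (metricC sym_g b a xp).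
    have -> : \sum_e grad p e * g p b e = du b p.
      by rewrite -(lower_grad b xp); apply: eq_bigr => e _; rewrite mulrC.
    have -> : \sum_c grad p c * (du c p * g p a b) = g p a b * N.
      by rewrite mulr_sumr; apply: eq_bigr => c _; abstract_ring.
    have -> : \sum_c grad p c * (du a p * g p b c) = du a p * du b p.
      rewrite -(lower_grad b xp) mulr_sumr; apply: eq_bigr => c _; abstract_ring.
    have -> : \sum_c grad p c * (g p c a * du b p) = du a p * du b p.
      rewrite -(sum_grad_metric a xp) mulr_suml; apply: eq_bigr => c _.
      by rewrite mulrA.
    by rewrite addrK.
  abstract_ring.
have E1 : \sum_c grad p c * pd x c (fun q => g q b a) p = W + V.
  rewrite -big_split; apply: eq_bigr => c _ /=.
  by rewrite (metric_compat sym_g unit_g b a c xp) mulrDr.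
rewrite EG E4 E5 E6 E7 E8 E1 (pd_comm b a smooth_u xp) (metricC sym_g b a xp).
rewrite -/Gdu -/TU -/N.
clear EG E4 E5 E6 E7 E8 E1; clearbody Gdu TU N V W T.
abstract_ring.
Qed.

End ConformalChange.

(** * The Hessian of e^{-u} and the Obata equation *)

Lemma hessian_expRN (R : realType) (n : nat) (M : topologicalType)
    (x : chart R n M) (g : M -> 'M[R]_n) (u : M -> R) p a b :
  smooth_in x u -> dom x p ->
  hessian x g (fun q => expR (- u q)) p a b =
  expR (- u p) * (pd x a u p * pd x b u p - hessian x g u p a b).
Proof.
move=> su xp; have sNu := smooth_inN su; have sphi := smooth_in_expR sNu.
have pdphi c q : dom x q ->
    pd x c (fun q => expR (- u q)) q = - (expR (- u q) * pd x c u q).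
  by move=> xq; rewrite pd_expR// pdN// mulrN.
rewrite !mxE /nabla1.
have -> : pd x a (fun q => pd x b (fun q => expR (- u q)) q) p =
    expR (- u p) * (pd x a u p * pd x b u p - pd x a (pd x b u) p).
  have sd := smooth_in_pd b su.
  rewrite (pd_eq (h := fun q => - (expR (- u q) * pd x b u q)) a _ xp).
    by rewrite pdN ?pdM ?pdphi//; [abstract_ring | exact: smooth_inM].
  by move=> q; exact: pdphi.
under eq_bigr do rewrite pdphi// mulrN mulrCA.
rewrite sumrN -mulr_sumr; ring.
Qed.

Unset Implicit Arguments.

Theorem mainTheorem6 (R : realType) (n : nat) (M : smooth_manifold R n)
  (g : pseudo_metric M) (Lambda : R) (u : M -> R) (Y : two_form M) (lambda : R)
  (hn : (3 <= n)%N) (hconn : connected [set: M])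
  (hE : einstein g Lambda) (hRS : cky_rs g u Y lambda) :
  forall x, atlas M x -> forall p, dom x p ->
  let phi (q : M) := expR (- u q) in
  let c := lambda - vf_app x (xi_vect x (g x) (Y x)) u p in
  let G := laplacian x (g x) u p + (n%:R - 2) * grad_sq x (g x) u p
           + c * expR (2 * u p) in
  let K := (Lambda - G) / (n%:R - 2) in
  hessian x (g x) phi p = - (K * phi p) *: g x p.
Proof.
move=> x ax p xp; case: hRS => su ckyY RS.
have smooth_g := comp_smooth g ax.
have sym_g := @Defs.metric_sym _ _ _ g x ax.
have unit_g := @Defs.metric_nondeg _ _ _ g x ax.
have smooth_Y := comp_smooth Y ax.
have smooth_u := su x ax.
have smooth_xi := smooth_xi_form smooth_g unit_g smooth_Y.
have killing := cky_killing hn smooth_g sym_g unit_g (hE x ax) smooth_Y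
  (@Defs.form_antisym _ _ _ Y x ax) (ckyY x ax).
move=> phi c G K; apply/matrixP => a b.
have n2 : n%:R - 2 != 0 :> R.
  by rewrite subr_eq0 eqr_nat; apply: contraTN hn => /eqP ->.
have eq_ab : ricci x (rescaled (g x) u) p a b
    + 2^-1 * lie x (xi_vect x (g x) (Y x)) (rescaled (g x) u) p a b
    = lambda * rescaled (g x) u p a b.
  have /matrixP/(_ a b) := RS x ax p xp.
  by rewrite [in LHS]mxE [X in _ + X]mxE [RHS]mxE.
(* As xi is Killing, only the term 2 xi(u) e^{2u} g is left of the Lie derivative of the rescaled
   metric. *)
have lie0 : lie x (xi_vect x (g x) (Y x)) (g x) p a b = 0.
  by rewrite (lie_metric smooth_g sym_g unit_g a b smooth_xi xp) killing.
move: eq_ab; rewrite (ricci_rescaled smooth_g sym_g unit_g smooth_u a b xp).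
rewrite (lie_rescaled smooth_g smooth_u smooth_xi xp).
have scaleE k (A : 'M[R]_n) : (k *: A) a b = k * A a b by rewrite mxE.
have addE (A B : 'M[R]_n) : (A + B) a b = A a b + B a b by rewrite mxE.
rewrite (hE x ax p xp) rescaledE !(scaleE, addE) lie0 addr0.
rewrite (hessian_expRN (g x) a b smooth_u xp) -/(phi p) /K /G /c.
rewrite -/(xi_vect x (g x) (Y x)).
move: (hessian _ _ _ _ _ _) (pd x a u p) (pd x b u p) (laplacian _ _ _ _).
move: (grad_sq _ _ _ _) (vf_app _ _ _ _) (expR _) (phi p) (g x p a b).
move: (n%:R - 2) n2 => m m0 S X e f gab H ua ub L E.
(* The soliton equation solved for u_a u_b minus the Hessian of u, which is e^u times the Hessian of
   e^{-u}; the inner bracket is [G], and [m] = n - 2 is then divided out. *)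
have Em : m * (ua * ub - H) = - (Lambda - (L + m * S + (lambda - X) * e)) * gab.
  by lra.
by apply: (mulfI m0); rewrite mulrCA Em; field.
Qed.
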